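(* Let $X \subseteq \mathbb{C}^N$ be a closed complex algebraic subset, equipped with the Euclidean (strong) topology inherited from $\mathbb{C}^N$, and let $f: X \to X$ be a polynomial map. Suppose that $f$ is an open map, that $X - f(X)$ is finite, and that $\Omega \subseteq X$ is a cofinite subset of $X$ (i.e. $X-\Omega$ is finite) with $f(\Omega) \subseteq \Omega$. Then there is an integer $K > 0$ such that $f^K(\Omega) = f^{k}(\Omega)$ for all $k \ge K$. Moreover, the stable image $\bigcap_{k>0} f^k(\Omega)$ is an open cofinite subset of $\Omega$.
   Context: $f^k$ denotes the $k$-fold composition $f\circ f\circ\cdots\circ f$. A polynomial map $X\to X$ is the restriction of a polynomial map $\mathbb{C}^N\to\mathbb{C}^N$ that sends $X$ into $X$. *)

(* Defs.v *)
From HB Require Import structures.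
From mathcomp Require Import all_boot all_order all_algebra.
From mathcomp Require Import reals.
From mathcomp Require Import complex.
From mathcomp Require Import mpoly.
From Stdlib Require Import List.

Set Implicit Arguments. Unset Strict Implicit. Unset Printing Implicit Defensive.
Import Order.TTheory GRing.Theory Num.Theory.
Local Open Scope ring_scope.
Delimit Scope complex_scope with C.

Section Defs.
Variable R : realType.
Local Notation C := (complex R).
Variable N : nat.
Local Notation pt := ('I_N -> C).

Definition zero_locus (S : {mpoly C[N]} -> Prop) : pt -> Prop :=
  fun x => forall p, S p -> p.@[x] = 0.

Definition poly_map (F : 'I_N -> {mpoly C[N]}) : pt -> pt :=
  fun x i => (F i).@[x].

(* U is open in X for the Euclidean topology of C^N restricted to X
   (balls for the sup norm, which induce the Euclidean topology) *)
Definition rel_open (X U : pt -> Prop) : Prop :=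
  (forall x, U x -> X x) /\
  forall x, U x -> exists2 e : R, 0 < e &
    forall y, X y -> (forall i, `|y i - x i| < (e%:C)%C) -> U y.

Definition finite_set (A : pt -> Prop) : Prop :=
  exists l : list pt, forall x, A x -> In x l.

Definition img (f : pt -> pt) (A : pt -> Prop) : pt -> Prop :=
  fun y => exists2 x, A x & f x = y.

Definition open_map_on (X : pt -> Prop) (f : pt -> pt) : Prop :=
  forall U, rel_open X U -> rel_open X (img f U).

End Defs.

(* Main.v *)
Require Import Defs.
From HB Require Import structures.
From mathcomp Require Import all_boot all_order all_algebra all_field.
From mathcomp Require Import reals complex mpoly boolp ring zify.
From Stdlib Require List.
Set Implicit Arguments. Unset Strict Implicit. Unset Printing Implicit Defensive.
Import Order.TTheory GRing.Theory Num.Theory.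
Local Open Scope ring_scope.

(** If the images [f^k(Omega)] never stabilize, some [a] in [Omega] has an orbit [y_k = f^k(a)] of
    pairwise distinct points with [y_k] not in [f^(k+1)(Omega)], and for [k] large the only preimage
    of [y_(k+1)] in [X] is [y_k].  The set [W] of points of [X] with at most one preimage is
    constructible, and it is closed for the Euclidean topology because [f] is open; hence it is
    Zariski closed, a constructible set being Euclidean dense in its Zariski closure.  So the points
    of [X] whose forward orbit lies in [W] form an algebraic set [E] containing [y_k] for [k]
    large, stable under [f], on which [f] is injective, hence surjective by Ax's theorem.  Thus
    [y_k] has an infinite backward orbit; it consists of distinct points, so it meets [Omega]
    arbitrarily far back, which contradicts the choice of [a].

    Ax's theorem is obtained by specializing Nullstellensatz certificates to a finite ring.  The
    density of constructible sets goes by induction on the dimension: in a generic direction,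
    either the line through the given point meets the Zariski closure nowhere else, and one projects
    along it, or the Zariski closure is a hypersurface, defined by a monic polynomial whose roots
    depend continuously on the coefficients. *)

(** * Noetherian rings and polynomials in several variables *)

(** The obstacle is that Ax's theorem speaks of algebraic sets, while having at most one preimage is
    a priori only a constructible condition. Openness of [f] bridges the gap: two distinct preimages
    of [y] have disjoint neighbourhoods whose images are both neighbourhoods of [y], so a point with
    two preimages cannot be approached by points with at most one.

    The orbit of [a] exists because [Omega - f(Omega)] is finite: such a point either has no
    preimage in [X] or is the image of one of the finitely many points of [X - Omega]. Every point
    of [f^k(Omega)] outside [f^(k+1)(Omega)] originates in this finite set, and a pigeonhole
    argument selects one origin that serves all [k].

    Irreducible components never appear: prime ideals are obtained from ideals maximal for a
    suitable property. Ax's theorem is cut into implications between polynomial equations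
    (stability, injectivity, absence of a preimage), each with its own certificates. *)

Lemma exists_argmin (T : Type) (P : T -> Prop) (m : T -> nat) :
  (exists x, P x) -> exists2 x, P x & forall y, P y -> (m x <= m y)%N.
Proof.
case=> x0 Px0; pose Q k := `[< exists2 x, P x & m x = k >].
have exQ : exists k, Q k by exists (m x0); apply/asboolP; exists x0.
case: (ex_minnP exQ) => k /asboolP[x Px <-] kmin.
by exists x => // y Py; apply: kmin; apply/asboolP; exists y.
Qed.

Section Ideals.
Variable A : comNzRingType.
Implicit Types I J : A -> Prop.

Definition is_ideal I :=
  [/\ I 0, (forall a b, I a -> I b -> I (a + b)) & forall a b, I b -> I (a * b)].

Definition is_prime I :=
  [/\ is_ideal I, ~ I 1 & forall a b, I (a * b) -> I a \/ I b].

Lemma ideal0 I : is_ideal I -> I 0. Proof. by case. Qed.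

Lemma idealD I a b : is_ideal I -> I a -> I b -> I (a + b).
Proof. by case=> _ + _; apply. Qed.

Lemma idealM I a b : is_ideal I -> I b -> I (a * b).
Proof. by case=> _ _; apply. Qed.

Lemma idealMr I a b : is_ideal I -> I a -> I (a * b).
Proof. by move=> Ii Ia; rewrite mulrC; apply: idealM. Qed.

Lemma idealN I a : is_ideal I -> I a -> I (- a).
Proof. by move=> Ii Ia; rewrite -mulN1r; apply: idealM. Qed.

Lemma idealB I a b : is_ideal I -> I a -> I b -> I (a - b).
Proof. by move=> Ii Ia Ib; apply: idealD => //; apply: idealN. Qed.

Lemma ideal_sum I (T : Type) (r : seq T) (P : pred T) (F : T -> A) :
  is_ideal I -> (forall i, P i -> I (F i)) -> I (\sum_(i <- r | P i) F i).
Proof.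
by move=> Ii IF; elim/big_ind: _ => // [|x y]; [apply: ideal0|apply: idealD].
Qed.

Lemma primeX I a k : is_prime I -> I (a ^+ k) -> I a.
Proof.
case=> _ I1 Ip; elim: k => [|k IHk]; first by rewrite expr0.
by rewrite exprS => /Ip[].
Qed.

(** Finite generation is stated by the universal property of the generated ideal; linear
    combinations are written out only in [span], for certificates whose coefficients matter. *)
Definition noetherian := forall I, is_ideal I ->
  exists2 l : seq A, (forall a, a \in l -> I a) &
    forall J, is_ideal J -> (forall a, a \in l -> J a) -> forall a, I a -> J a.

Lemma noetherian_chain (I : nat -> A -> Prop) : noetherian ->
  (forall k, is_ideal (I k)) -> (forall k a, I k a -> I k.+1 a) ->
  exists K, forall k a, I k a -> I K a.
Proof.
move=> noeth Ii Iinc.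
have Ile j k a : (j <= k)%N -> I j a -> I k a.
  move=> jk Ija; rewrite -(subnK jk); elim: (k - j)%N => // d IHd.
  by rewrite addSn; apply: Iinc.
pose V a := exists k, I k a.
have Vi : is_ideal V.
  split=> [|a b [i Ia] [j Ib]|a b [i Ib]]; first by exists 0; apply: ideal0.
  - exists (maxn i j); apply: idealD => //.
      by apply: Ile Ia; rewrite leq_maxl.
    by apply: Ile Ib; rewrite leq_maxr.
  - by exists i; apply: idealM.
have [l lV lgen] := noeth _ Vi.
have [K lK] : exists K, forall a, a \in l -> I K a.
  elim: l lV {lgen} => [|x l IHl] lV; first by exists 0.
  have [|K1 H1] := IHl; first by move=> a al; apply: lV; rewrite inE al orbT.
  have [K2 H2] : V x by apply: lV; rewrite inE eqxx.
  exists (maxn K1 K2) => a; rewrite inE => /predU1P[->|/H1].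
    by apply: Ile H2; rewrite leq_maxr.
  by apply: Ile; rewrite leq_maxl.
by exists K => k a Ia; apply: (lgen _ (Ii K) lK); exists k.
Qed.

(** Otherwise dependent choice yields a strictly increasing chain, against [noetherian_chain]. *)
Lemma noetherian_max (P : (A -> Prop) -> Prop) : noetherian ->
  (forall I, P I -> is_ideal I) -> (exists I, P I) ->
  exists2 I, P I & forall J, P J -> (forall a, I a -> J a) -> forall a, J a -> I a.
Proof.
move=> noeth Pi [I0 PI0]; apply: contrapT => nmax.
have next (I : {I | P I}) :
    {J : {J | P J} | (forall a, sval I a -> sval J a) /\ exists2 a, sval J a & ~ sval I a}.
  apply: cid; case: I => I PI /=; apply: contrapT => noJ; apply: nmax.
  exists I => // J PJ IJ a Ja; apply: contrapT => nIa.
  by apply: noJ; exists (exist _ J PJ); split=> //; exists a.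
pose c k := iter k (fun I : {I | P I} => sval (next I)) (exist P I0 PI0).
have [|||K cK] := @noetherian_chain (fun k => sval (c k)).
- by [].
- by move=> k; apply: Pi; case: (c k).
- by move=> k a; rewrite /c iterS -/(c k); case: (next (c k)) => J /= [+ _]; apply.
have : exists2 a, sval (c K.+1) a & ~ sval (c K) a.
  by rewrite {1}/c iterS -/(c K); case: (next (c K)) => J /= [].
by case=> a /cK.
Qed.

Definition span (l : seq A) (a : A) := exists c : nat -> A, a = \sum_(i < size l) c i * l`_i.

Lemma span_ideal l : is_ideal (span l).
Proof.
split=> [|a b [c ->] [d ->]|a b [c ->]].
- by exists (fun=> 0); rewrite big1 // => i _; rewrite mul0r.
- exists (fun i => c i + d i); rewrite -big_split /=.
  by apply: eq_bigr => i _; rewrite mulrDl.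
- exists (fun i => a * c i); rewrite mulr_sumr.
  by apply: eq_bigr => i _; rewrite mulrA.
Qed.

Lemma mem_span l a : a \in l -> span l a.
Proof.
move=> al; exists (fun i => (i == index a l)%:R).
have il : (index a l < size l)%N by rewrite index_mem.
rewrite (bigD1 (Ordinal il)) //= eqxx mul1r nth_index // big1 ?addr0 // => i.
by rewrite -val_eqE /= => /negPf->; rewrite mul0r.
Qed.

End Ideals.

Lemma preim_ideal (A B : comNzRingType) (f : {rmorphism A -> B}) (I : B -> Prop) :
  is_ideal I -> is_ideal (fun a => I (f a)).
Proof.
move=> Ii; split=> [|a b Ia Ib|a b Ib]; rewrite ?rmorph0 ?rmorphD ?rmorphM.
- exact: ideal0.
- exact: idealD.
- exact: idealM.
Qed.

Lemma preim_prime (A B : comNzRingType) (f : {rmorphism A -> B}) (I : B -> Prop) :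
  is_prime I -> is_prime (fun a => I (f a)).
Proof.
case=> Ii I1 Ip; split; first exact: preim_ideal.
  by rewrite rmorph1.
by move=> a b; rewrite rmorphM; apply: Ip.
Qed.

Lemma noetherian_surj (A B : comNzRingType) (f : {rmorphism A -> B}) :
  (forall b, exists a, f a = b) -> noetherian A -> noetherian B.
Proof.
move=> fs noeth I Ii; have [l lI lgen] := noeth _ (preim_ideal f Ii).
exists (map f l) => [b /mapP[a al ->]|J Ji lJ b]; first exact: lI.
have [a <-] := fs b; apply: (lgen _ (preim_ideal f Ji)) => a' al.
by apply: lJ; apply: map_f.
Qed.

Lemma field_noetherian (K : fieldType) : noetherian K.
Proof.
move=> I Ii; case: (pselect (exists2 a, I a & a != 0)) => [[a Ia a0]|noa].
  exists [:: a] => [b|J Ji lJ b _]; first by rewrite inE => /eqP->.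
  by rewrite -[b](mulfVK a0); apply: idealM => //; apply: lJ; rewrite inE.
exists [::] => // J Ji _ b Ib; suff -> : b = 0 by apply: ideal0.
by apply/eqP/negPn/negP => b0; apply: noa; exists b.
Qed.

Section HilbertBasis.
Variable B : comNzRingType.
Implicit Type I : {poly B} -> Prop.

(** Bounding the size instead of fixing it admits [b = 0], which makes this an ideal. *)
Definition lead_ideal I d (b : B) := exists2 q, I q & (size q <= d.+1)%N /\ q`_d = b.

Lemma lead_ideal_ideal I d : is_ideal I -> is_ideal (lead_ideal I d).
Proof.
move=> Ii; split=> [|a b [p Ip [sp <-]] [q Iq [sq <-]]|a b [q Iq [sq <-]]].
- by exists 0; [apply: ideal0|rewrite size_poly0 coef0].
- exists (p + q); first exact: idealD.
  by rewrite coefD (leq_trans (size_polyD _ _)) // geq_max sp.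
- exists (a%:P * q); first exact: idealM.
  by rewrite coefCM mul_polyC (leq_trans (size_scale_leq _ _)).
Qed.

Lemma lead_ideal_shift I d k b : is_ideal I ->
  lead_ideal I d b -> lead_ideal I (d + k) b.
Proof.
move=> Ii [q Iq [sq qd]]; exists ('X^k * q); first exact: idealM.
rewrite coefXnM ltnNge leq_addl /= addnK; split=> //.
apply: leq_trans (size_polyMleq _ _) _; rewrite size_polyXn /=.
by rewrite -addSn addnC leq_add2r.
Qed.

Lemma seq_lift (T : Type) (U : eqType) (P : U -> T -> Prop) (l : seq U) :
  (forall b, b \in l -> exists q, P b q) ->
  exists l' : seq T, size l' = size l /\ forall i x0 y0, (i < size l)%N -> P (nth x0 l i) (nth y0 l' i).
Proof.
elim: l => [|x l IHl] H; first by exists [::].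
have [q Pq] := H x (mem_head _ _).
have [|l' [sl' Hl']] := IHl; first by move=> b bl; apply: H; rewrite inE bl orbT.
exists (q :: l'); split; first by rewrite /= sl'.
by case=> [|i] x0 y0 //= il; apply: Hl'.
Qed.

(** The element found must lie in [I] as well as in [J], because the descent of [hilbert_basis]
    subtracts it and continues with an element of [I]. *)
Lemma lead_ideal_fg I d : noetherian B -> is_ideal I ->
  exists2 l : seq {poly B}, (forall q, q \in l -> I q) &
    forall J, is_ideal J -> (forall q, q \in l -> J q) ->
    forall b, lead_ideal I d b -> lead_ideal (fun q => J q /\ I q) d b.
Proof.
move=> noeth Ii; have [lb lbI lbgen] := noeth _ (lead_ideal_ideal d Ii).
have [|l [sl Hl]] :=
  @seq_lift _ _ (fun b q => I q /\ (size q <= d.+1)%N /\ q`_d = b) lb.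
  by move=> b /lbI[q Iq Hq]; exists q.
exists l => [q ql|J Ji lJ].
  have := Hl (index q l) 0 0; rewrite -sl index_mem ql nth_index //.
  by case=> // ->.
apply: lbgen.
  apply: lead_ideal_ideal.
  split=> [|p q [Jp Ip] [Jq Iq]|p q [Jq Iq]]; first by split; apply: ideal0.
    by split; apply: idealD.
  by split; apply: idealM.
move=> b bl; have il : (index b lb < size lb)%N by rewrite index_mem.
have [] := Hl _ 0 0 il; rewrite nth_index // => Iq Hq.
exists l`_(index b lb) => //; split=> //; apply: lJ; apply: mem_nth.
by rewrite sl.
Qed.

(** The ideals [lead_ideal I d] increase with [d] and stop at some [D]. Lifts of generators for all
    [d <= D] generate [I], since subtracting a combination of them lowers the size of any element of
    [I]. *)
Theorem hilbert_basis : noetherian B -> noetherian {poly B}.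
Proof.
move=> noeth I Ii.
have [||D HD] := noetherian_chain (I := lead_ideal I) noeth.
- by move=> k; apply: lead_ideal_ideal.
- by move=> k b; rewrite -addn1; apply: lead_ideal_shift.
have [l lI lgen] : exists2 l : seq {poly B}, (forall q, q \in l -> I q) &
    forall J, is_ideal J -> (forall q, q \in l -> J q) ->
    forall d, (d <= D)%N -> forall b, lead_ideal I d b ->
    lead_ideal (fun q => J q /\ I q) d b.
  elim: D {HD} => [|D [l lI lgen]].
    have [l lI lgen] := lead_ideal_fg 0 noeth Ii.
    by exists l => // J Ji lJ d; rewrite leqn0 => /eqP->; apply: lgen.
  have [l' lI' lgen'] := lead_ideal_fg D.+1 noeth Ii.
  exists (l ++ l') => [q|J Ji lJ d].
    by rewrite mem_cat => /orP[/lI|/lI'].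
  rewrite leq_eqVlt => /orP[/eqP->|]; [apply: lgen'|apply: lgen] => // q ql;
    by apply: lJ; rewrite mem_cat ql ?orbT.
exists l => // J Ji lJ q.
have [n] := ubnP (size q); elim: n q => // n IHn q sqn Iq.
have JIi : is_ideal (fun q => J q /\ I q).
  split=> [|p r [Jp Ip] [Jr Ir]|p r [Jr Ir]]; first by split; apply: ideal0.
    by split; apply: idealD.
  by split; apply: idealM.
have [->|q0] := eqVneq q 0; first exact: ideal0.
have [r [Jr Ir] [sr rd]] :
    lead_ideal (fun q => J q /\ I q) (size q).-1 (lead_coef q).
  have Hq : lead_ideal I (size q).-1 (lead_coef q).
    by exists q => //; rewrite lead_coefE prednK ?size_poly_gt0.
  have [le|lt] := leqP (size q).-1 D; first exact: lgen.
  by rewrite -(subnKC (ltnW lt)); apply: lead_ideal_shift => //;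
     apply: lgen => //; apply: HD Hq.
rewrite -(subrK r q); apply: idealD => //; apply: IHn; last exact: idealB.
rewrite prednK ?size_poly_gt0 // in sr.
rewrite ltnS in sqn; apply: leq_trans sqn; rewrite ltnNge.
apply/negP => le; have seq : size (q - r) = size q.
  apply/eqP; rewrite eqn_leq le andbT (leq_trans (size_polyD _ _)) //.
  by rewrite size_polyN geq_max leqnn.
have /eqP : lead_coef (q - r) = 0.
  by rewrite lead_coefE seq coefB rd -lead_coefE subrr.
by rewrite lead_coef_eq0 -size_poly_eq0 seq size_poly_eq0 (negPf q0).
Qed.

End HilbertBasis.

Lemma mpoly_rmorph_eq n (R : nzRingType) (S : comNzRingType)
    (f g : {rmorphism {mpoly R[n]} -> S}) :
  (forall c, f c%:MP = g c%:MP) -> (forall i, f 'X_i = g 'X_i) -> f =1 g.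
Proof.
move=> fgC fgX p; rewrite [p]mpolyE !rmorph_sum; apply: eq_bigr => m _.
rewrite -mul_mpolyC !rmorphM fgC; congr (_ * _).
rewrite mpolyXE_id !rmorph_prod; apply: eq_bigr => i _.
by rewrite !rmorphXn fgX.
Qed.

Lemma mmap_comp n m (R : nzRingType) (S T : comNzRingType)
    (f : {rmorphism R -> S}) (g : {rmorphism S -> T}) (h : 'I_n -> {mpoly S[m]})
    (k : 'I_m -> T) (p : {mpoly R[n]}) :
  mmap g k (mmap (@mpolyC m S \o f) h p) = mmap (g \o f) (fun i => mmap g k (h i)) p.
Proof.
apply: (mpoly_rmorph_eq (f := mmap g k \o mmap (@mpolyC m S \o f) h)
  (g := mmap (g \o f) (fun i => mmap g k (h i)))) => [c|i] /=.
  by rewrite mmapC /= !mmapC.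
by rewrite !mmapX !mmap1U.
Qed.

Section Points.
Variables (n : nat) (T : Type).

Definition widen_pt (x : 'I_n.+1 -> T) : 'I_n -> T :=
  fun i => x (widen_ord (leqnSn n) i).

Definition rcons_pt (t : 'I_n -> T) (s : T) : 'I_n.+1 -> T :=
  fun i => if unlift ord_max i is Some j then t j else s.

Lemma rcons_pt_max t s : rcons_pt t s ord_max = s.
Proof. by rewrite /rcons_pt unlift_none. Qed.

Lemma widen_rcons_pt t s : widen_pt (rcons_pt t s) = t.
Proof.
apply/funext => i; rewrite /widen_pt /rcons_pt.
have -> : widen_ord (leqnSn n) i = lift ord_max i.
  by apply: val_inj; rewrite /= /bump leqNgt ltn_ord.
by rewrite liftK.
Qed.

Lemma rcons_pt_eta x : rcons_pt (widen_pt x) (x ord_max) = x.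
Proof.
apply/funext => i; rewrite /rcons_pt; case: unliftP => [j|] -> //.
rewrite /widen_pt; congr x; apply: val_inj.
by rewrite /= /bump leqNgt ltn_ord.
Qed.

End Points.

Section LastVariable.
Variables (n : nat) (R : comNzRingType).

Definition mpoly_of_poly : {poly {mpoly R[n]}} -> {mpoly R[n.+1]} :=
  horner_eval 'X_ord_max \o map_poly (@mwiden n R).

HB.instance Definition _ := GRing.RMorphism.on mpoly_of_poly.

Lemma mpoly_of_polyC c : mpoly_of_poly c%:P = mwiden c.
Proof. by rewrite /mpoly_of_poly /= map_polyC /= /horner_eval hornerC. Qed.

Lemma mpoly_of_polyX : mpoly_of_poly 'X = 'X_ord_max.
Proof. by rewrite /mpoly_of_poly /= map_polyX /horner_eval hornerX. Qed.

Lemma mmap_mwiden (S : comNzRingType) (f : {rmorphism R -> S}) (x : 'I_n.+1 -> S) p :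
  mmap f x (mwiden p) = mmap f (widen_pt x) p.
Proof.
apply: (mpoly_rmorph_eq (f := mmap f x \o @mwiden n R)
  (g := mmap f (widen_pt x))) => [c|i] /=.
  by rewrite mwidenC !mmapC.
by rewrite /mwiden !mmapX !mmap1U mmapX mmap1U.
Qed.

Lemma mmap_mpoly_of_poly (S : comNzRingType) (f : {rmorphism R -> S}) (x : 'I_n.+1 -> S) q :
  mmap f x (mpoly_of_poly q) = (map_poly (mmap f (widen_pt x)) q).[x ord_max].
Proof.
elim/poly_ind: q => [|q c IHq]; first by rewrite !rmorph0 horner0.
rewrite !(rmorphD, rmorphM) /= IHq mpoly_of_polyX mpoly_of_polyC mmap_mwiden.
by rewrite map_polyX map_polyC !hornerE /= mmapX mmap1U.
Qed.

Lemma mpoly_of_poly_surj p : exists q, mpoly_of_poly q = p.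
Proof.
pose Q p := exists q, mpoly_of_poly q = p.
have Q1 : Q 1 by exists 1; rewrite rmorph1.
have QD a b : Q a -> Q b -> Q (a + b).
  by case=> a' <- [b' <-]; exists (a' + b'); rewrite rmorphD.
have QM a b : Q a -> Q b -> Q (a * b).
  by case=> a' <- [b' <-]; exists (a' * b'); rewrite rmorphM.
have QC c : Q c%:MP by exists c%:MP%:P; rewrite mpoly_of_polyC mwidenC.
have QX i : Q 'X_i.
  have [lt|ge] := ltnP i n.
    exists ('X_(Ordinal lt))%:P; rewrite mpoly_of_polyC /mwiden mmapX mmap1U.
    by congr 'X_ _; apply: val_inj.
  exists 'X; rewrite mpoly_of_polyX; congr 'X_ _; apply: val_inj => /=.
  by apply/eqP; rewrite eqn_leq ge -ltnS ltn_ord.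
have QXn i k : Q ('X_i ^+ k) by elim: k => // k IHk; rewrite exprS; apply: QM.
rewrite -/(Q p) [p]mpolyE; apply: (big_ind Q) => //; first by exists 0; rewrite rmorph0.
move=> m _; rewrite -mul_mpolyC mpolyXE_id; apply: (QM) => //.
by apply: (big_ind Q Q1 QM).
Qed.

End LastVariable.

Lemma mpoly_noetherian (K : fieldType) n : noetherian {mpoly K[n]}.
Proof.
elim: n => [|n IHn].
  apply: (@noetherian_surj _ _ (@mpolyC 0 K)); last exact: (@field_noetherian K).
  move=> p; exists (p@_0%MM); apply/mpolyP => m; rewrite mcoeffC.
  have -> : m = 0%MM by apply/mnmP; case.
  by rewrite eqxx mulr1.
apply: (@noetherian_surj _ _ (@mpoly_of_poly n K)).
  exact: mpoly_of_poly_surj.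
exact: hilbert_basis.
Qed.

Lemma point_ideal n (R : comNzRingType) (x : 'I_n -> R) :
  is_ideal (fun q : {mpoly R[n]} => q.@[x] = 0).
Proof.
split=> [|p q Hp Hq|p q Hq]; first exact: meval0.
  by rewrite mevalD Hp Hq addr0.
by rewrite mevalM Hq mulr0.
Qed.

Lemma vanishing_ideal n (R : comNzRingType) (U : ('I_n -> R) -> Prop) :
  is_ideal (fun q : {mpoly R[n]} => forall x, U x -> q.@[x] = 0).
Proof.
split=> [x _|p q Hp Hq x Ux|p q Hq x Ux]; first exact: meval0.
  by rewrite mevalD Hp // Hq // addr0.
by rewrite mevalM Hq // mulr0.
Qed.

(** * Specialization of prime ideals *)

Section PolyIdeals.
Variable B : idomainType.
Implicit Types p J : {poly B} -> Prop.

Lemma ideal_trunc J (N : B -> Prop) q : is_ideal J -> N 0 ->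
  (forall b, N b -> J b%:P) -> J q -> ~ (forall i, N q`_i) ->
  exists2 q', J q' & ~ N (lead_coef q') /\ (size q' <= size q)%N.
Proof.
move=> Ji N0 NJ; have [n] := ubnP (size q); elim: n q => // n IHn q sq Jq nN.
case: (pselect (N (lead_coef q))) => [Nl|nNl]; last by exists q.
have q0 : q != 0 by apply/eqP => q0; apply: nN => i; rewrite q0 coef0.
have sq0 : (0 < size q)%N by rewrite size_poly_gt0.
pose r := q - (lead_coef q)%:P * 'X^((size q).-1).
have rE i : r`_i = if i == (size q).-1 then 0 else q`_i.
  rewrite coefB coefCM coefXn; case: eqP => [->|_]; first by rewrite mulr1 subrr.
  by rewrite mulr0 subr0.
have sr : (size r < size q)%N.
  rewrite -(prednK sq0) ltnS; apply/leq_sizeP => j; rewrite rE.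
  case: eqP => // /eqP jn jge; apply: nth_default.
  by rewrite -(prednK sq0) ltn_neqAle eq_sym jn.
have [|||q' Jq' [nN' sq']] := IHn r.
- exact: leq_trans sr sq.
- by apply: idealB => //; apply: idealMr => //; apply: NJ.
- move=> Nr; apply: nN => i; have := Nr i; rewrite rE.
  by case: eqP => // -> _; rewrite -lead_coefE.
- by exists q' => //; split=> //; apply: leq_trans sq' (ltnW sr).
Qed.

(** [N] collects the constants regarded as zero. When [N] is prime, [P] plays the role of a
    generator of [J] over the fraction field of the quotient by [N]. *)
Lemma min_lead J (N : B -> Prop) : is_ideal J -> N 0 -> (forall b, N b -> J b%:P) ->
  (exists2 q, J q & ~ (forall i, N q`_i)) ->
  exists P, [/\ J P, ~ N (lead_coef P) &
    forall q, J q -> (size q < size P)%N -> forall i, N q`_i].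
Proof.
move=> Ji N0 NJ [q0 Jq0 nN0].
have [|P [JP nNP] Pmin] := @exists_argmin _ (fun q => J q /\ ~ N (lead_coef q)) (fun q => size q).
  by have [q' Jq' [nN' _]] := ideal_trunc Ji N0 NJ Jq0 nN0; exists q'.
exists P; split=> // q Jq sq; apply: contrapT => nNq.
have [q' Jq' [nN' sq']] := ideal_trunc Ji N0 NJ Jq nNq.
by have := leq_trans sq (leq_trans (Pmin q' (conj Jq' nN')) sq'); rewrite ltnn.
Qed.


Definition trace p : B -> Prop := fun b => p b%:P.

Lemma trace_prime p : is_prime p -> is_prime (trace p).
Proof. exact: (preim_prime (polyC : {rmorphism B -> {poly B}})). Qed.

Lemma coefs_ideal p (q : {poly B}) : is_ideal p -> (forall i, trace p q`_i) -> p q.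
Proof.
move=> Ii qi; rewrite -[q]coefK poly_def; apply: ideal_sum => // i _.
by rewrite -mul_polyC; apply: idealMr => //; apply: qi.
Qed.

Import Pdiv.Idomain.

(* A remainder modulo a minimal element of an ideal vanishes modulo [trace p], so pseudo-dividing
   [P] and [g] by a minimal element of [p + (g)] forces this element to be a constant. *)
Lemma bezout_prime p P g : is_prime p -> p P -> ~ trace p (lead_coef P) ->
  (forall q, p q -> (size q < size P)%N -> forall i, trace p q`_i) -> ~ p g ->
  exists h v, ~ trace p h /\ p (h%:P - v * g).
Proof.
move=> pp pP nlP Pmin npg; have [Ip _ pM] := pp; have tp := trace_prime pp.
have [It _ tM] := tp.
pose J q := exists v, p (q - v * g).
have Ji : is_ideal J.
  split=> [|a b [v Hv] [w Hw]|a b [v Hv]].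
  - by exists 0; rewrite mul0r subr0; apply: ideal0.
  - by exists (v + w); rewrite mulrDl opprD addrACA; apply: idealD.
  - by exists (a * v); rewrite -mulrA -mulrBr; apply: idealM.
have pJ q : p q -> J q by move=> pq; exists 0; rewrite mul0r subr0.
have Jg : J g by exists 1; rewrite mul1r subrr; apply: ideal0.
have t0 : trace p 0 by apply: ideal0.
have [|q [Jq nlq qmin]] := min_lead Ji t0 (fun b => @pJ b%:P).
  by exists P; [apply: pJ|move=> /(_ (size P).-1)].
have q0 : q != 0 by apply/eqP => q0; apply: nlq; rewrite q0 lead_coef0.
have rem a : J a -> p (a %% q).
  move=> Ja; apply: coefs_ideal => //; apply: qmin; last by rewrite ltn_modp.
  have -> : a %% q = lead_coef q ^+ scalp a q *: a - a %/ q * q by rewrite divp_eq addrC addKr.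
  by apply: idealB => //; [rewrite -mul_polyC|]; apply: idealM.
have nlqX k : ~ trace p (lead_coef q ^+ k) by move=> /(primeX tp).
have := divp_eq P q; set s := P %/ q; set r := P %% q; set c := _ ^+ _ => E.
have pr : p r by apply: rem; apply: pJ.
have : p (s * q).
  have -> : s * q = c *: P - r by rewrite E addrK.
  by apply: idealB => //; rewrite -mul_polyC; apply: idealM.
have c0 : c != 0 by apply/eqP => c0; apply: (nlqX (scalp P q)); rewrite -/c c0.
have nclP : ~ trace p (c * lead_coef P) by move=> /tM[/nlqX|].
(* If [q] is in [p], pseudo-dividing [g] by [q] puts a multiple of [g] by a constant outside
   [trace p], hence [g], in [p]. So [s] is in [p]; were [q] not constant, [s] would be smaller than
   [P], its leading coefficient would be in [trace p], and so would that of [c *: P]. *)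
case/pM => [ps|pq]; last first.
  have := divp_eq g q => Eg; have pr' := rem _ Jg.
  have : p ((lead_coef q ^+ scalp g q)%:P * g).
    by rewrite mul_polyC Eg; apply: idealD => //; apply: idealM.
  by case/pM => // /nlqX.
have s0 : s != 0.
  apply/eqP => s0; move: E; rewrite s0 mul0r add0r => E.
  apply: nclP; rewrite -[c * _]lead_coefZ E lead_coefE.
  apply: qmin; first exact: pJ.
  by rewrite ltn_modp.
have srq : (size r < size (s * q)%R)%N.
  rewrite size_mul // -subn1 ltn_subRL add1n.
  have lrq : (size r < size q)%N by rewrite ltn_modp.
  apply: leq_ltn_trans lrq _; by rewrite -[X in (X < _)%N]add0n ltn_add2r size_poly_gt0.
have Elead : c * lead_coef P = lead_coef s * lead_coef q.
  by rewrite -lead_coefZ E lead_coefDl // lead_coefM.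
have sP : size P = (size s + size q).-1.
  by rewrite -(size_scale P c0) E size_polyDl // size_mul.
have [sq1|sq1] := leqP (size q) 1.
  have Eq : q = (q`_0)%:P by apply: size1_polyC.
  case: (Jq) => v Hv; exists q`_0, v; split; last by rewrite -Eq.
  by move: nlq; rewrite {1}Eq lead_coefC.
case: nclP; rewrite Elead mulrC; apply: idealM => //.
rewrite lead_coefE; apply: Pmin => //.
by rewrite sP -subn1 ltn_subRL addnC ltn_add2l.
Qed.

(** Elimination of one variable. If some element of [p] is nonzero modulo [trace p], then [t] is a
    root of a minimal one, whose leading coefficient must survive under [phi], and the relation
    [h = v * g] modulo [p] keeps [g] nonzero at [t]. Otherwise every [t] is a zero of [p], and one
    outside the zeros of [g] is taken. *)
Lemma prime_specialize1 p g : is_prime p -> ~ p g ->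
  exists2 h, ~ trace p h & forall (W : closedFieldType) (phi : {rmorphism B -> W}),
    (forall b, trace p b -> phi b = 0) -> phi h != 0 ->
    exists t, (forall q, p q -> (map_poly phi q).[t] = 0) /\ (map_poly phi g).[t] != 0.
Proof.
move=> pp npg; have [Ip p1 pM] := pp; have tp := trace_prime pp.
have [It _ tM] := tp; have t0 : trace p 0 by apply: ideal0.
have map0 (W : closedFieldType) (phi : {rmorphism B -> W}) (q : {poly B}) :
    (forall b, trace p b -> phi b = 0) -> (forall i, trace p q`_i) -> map_poly phi q = 0.
  by move=> phi0 qi; apply/polyP => i; rewrite coef_map coef0; apply: phi0.
case: (pselect (exists2 q, p q & ~ (forall i, trace p q`_i))) => [exq|nex]; last first.
  have pcoef q : p q -> forall i, trace p q`_i.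
    by move=> pq i; apply: contrapT => nq; apply: nex; exists q => // /(_ i).
  have /existsNP[i ngi] : ~ (forall i, trace p g`_i) by move/(coefs_ideal Ip).
  exists g`_i => // W phi phi0 phih; set G := map_poly phi g.
  have G0 : G != 0.
    by apply/eqP => /polyP/(_ i); rewrite coef_map coef0; apply/eqP.
  have [t Gt] : exists t, G.[t] != 0.
    (* A root of [G - 1] is a point where [G] is nonzero; there is one unless [G - 1] is a nonzero
       constant, in which case [G] is constant too. *)
    have [sG|sG] := eqVneq (size (G - 1)) 1; last first.
      have /closed_rootP[t /rootP] := sG; rewrite !hornerE => /eqP.
      by rewrite subr_eq0 => /eqP Gt; exists t; rewrite Gt oner_neq0.
    have EG : G = (G`_0)%:P.
      apply: size1_polyC; rewrite -[G](subrK 1) (leq_trans (size_polyD _ _)) //.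
      by rewrite sG size_poly1.
    by exists 0; rewrite EG hornerC -polyC_eq0 -EG.
  by exists t; split=> // q /pcoef qi; rewrite (map0 W phi) ?horner0.
have [P [pP nlP Pmin]] := min_lead Ip t0 (fun b (tb : trace p b) => tb) exq.
have [h [v [nh phv]]] := bezout_prime pp pP nlP Pmin npg.
exists (h * lead_coef P) => [/tM[]//|W phi phi0].
rewrite rmorphM mulf_eq0 negb_or => /andP[phih phil].
have sphiP : size (map_poly phi P) = size P by rewrite size_map_poly_id0.
have /closed_rootP[t /rootP rt] : size (map_poly phi P) != 1.
  rewrite sphiP; apply/eqP => sP; apply: nlP.
  have EP := size1_polyC (eq_leq sP).
  by rewrite EP lead_coefC /trace -EP.
have P0 : P != 0 by apply/eqP => P0; apply: nlP; rewrite P0 lead_coef0.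
have root q : p q -> (map_poly phi q).[t] = 0.
  move=> pq; have E := divp_eq q P.
  have : map_poly phi (q %% P) = 0.
    apply: map0 => //; apply: Pmin; last by rewrite ltn_modp.
    have -> : q %% P = lead_coef P ^+ scalp q P *: q - q %/ P * P by rewrite E addrC addKr.
    by apply: idealB => //; [rewrite -mul_polyC|]; apply: idealM.
  move=> r0; have := congr1 (fun f => (map_poly phi f).[t]) E.
  rewrite -mul_polyC !rmorphD !rmorphM /= r0 map_polyC !hornerE rt mulr0 ?addr0 /=.
  by rewrite rmorphXn => /eqP; rewrite mulf_eq0 expf_eq0 (negPf phil) andbF => /eqP.
exists t; split=> //; apply/eqP => gt.
have := root _ phv; rewrite rmorphB rmorphM /= map_polyC !hornerE gt mulr0 ?subr0 ?oppr0 ?addr0 /=.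
by apply/eqP.
Qed.

End PolyIdeals.

(* This yields both Hilbert's Nullstellensatz ([R = W] algebraically closed) and the existence of
   specializations of finitely generated domains to positive characteristic ([R = int]). *)
Lemma prime_specialize n (R : idomainType) (p : {mpoly R[n]} -> Prop) g :
  is_prime p -> ~ p g ->
  exists2 a : R, ~ p a%:MP & forall (W : closedFieldType) (phi : {rmorphism R -> W}),
    (forall b : R, p b%:MP -> phi b = 0) -> phi a != 0 ->
    exists c : 'I_n -> W, (forall q, p q -> mmap phi c q = 0) /\ mmap phi c g != 0.
Proof.
elim: n p g => [|n IHn] p g pp npg.
  have mC (q : {mpoly R[0]}) : q = (q@_0%MM)%:MP.
    apply/mpolyP => m; rewrite mcoeffC.
    by have -> : m = 0%MM; [apply/mnmP; case|rewrite eqxx mulr1].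
  exists (g@_0%MM); first by rewrite -mC.
  move=> W phi phi0 phig; exists (fun=> 0); split=> [q|].
    by rewrite (mC q) mmapC; apply: phi0.
  by rewrite (mC g) mmapC.
have [g' Eg] := mpoly_of_poly_surj g.
have pp' := preim_prime (@mpoly_of_poly n R) pp.
have npg' : ~ p (mpoly_of_poly g') by rewrite Eg.
have [h nh Hh] := prime_specialize1 pp' npg'.
have [a na Ha] := IHn _ _ (trace_prime pp') nh.
have trC (b : R) : trace (fun q => p (@mpoly_of_poly n R q)) b%:MP = p b%:MP.
  by rewrite /trace mpoly_of_polyC mwidenC.
exists a => [|W phi phi0 phia]; first by rewrite trC in na.
have [|c [c0 ch]] := Ha W phi _ phia; first by move=> b; rewrite trC; apply: phi0.
have [t [t0 tg]] := Hh W (mmap phi c) c0 ch.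
exists (rcons_pt c t); split=> [q|].
  have [q' <-] := mpoly_of_poly_surj q.
  by rewrite mmap_mpoly_of_poly widen_rcons_pt rcons_pt_max; apply: t0.
by rewrite -Eg mmap_mpoly_of_poly widen_rcons_pt rcons_pt_max.
Qed.

(** * The Nullstellensatz and Ax's theorem *)

Section Nullstellensatz.
Variables (K : closedFieldType) (n : nat).
Implicit Types (I : {mpoly K[n]} -> Prop) (g : {mpoly K[n]}).

Definition add_ideal I g : {mpoly K[n]} -> Prop := fun q => exists v, I (q - v * g).

Lemma add_ideal_ideal I g : is_ideal I -> is_ideal (add_ideal I g).
Proof.
move=> Ii; split=> [|a b [v Hv] [w Hw]|a b [v Hv]].
- by exists 0; rewrite mul0r subr0; apply: ideal0.
- by exists (v + w); rewrite mulrDl opprD addrACA; apply: idealD.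
- by exists (a * v); rewrite -mulrA -mulrBr; apply: idealM.
Qed.

(** An ideal containing [I] and maximal among those avoiding all powers of [g] is prime;
    [prime_specialize] over [K] itself gives a zero of it where [g] is nonzero. *)
Theorem nullstellensatz I g : is_ideal I ->
  (forall c, (forall q, I q -> q.@[c] = 0) -> g.@[c] = 0) -> exists m, I (g ^+ m).
Proof.
move=> Ii vanish; apply: contrapT => nIg.
pose P J := [/\ is_ideal J, forall q, I q -> J q & ~ exists m, J (g ^+ m)].
have [||p [pi Ip npg] pmax] := noetherian_max (@mpoly_noetherian K n) (P := P).
- by move=> J [].
- by exists I; split.
have in_max a : ~ p a -> exists m, add_ideal p a (g ^+ m).
  move=> npa; apply: contrapT => nex; apply: npa; apply: (pmax (add_ideal p a)).
  - split=> //; first exact: add_ideal_ideal.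
    by move=> q Iq; exists 0; rewrite mul0r subr0; apply: Ip.
  - by move=> q pq; exists 0; rewrite mul0r subr0.
  - by exists 1; rewrite mul1r subrr; apply: ideal0.
have pp : is_prime p.
  split=> // [p1|a b pab].
    by apply: npg; exists 0; rewrite expr0.
  apply: contrapT => /not_orP[/in_max[m [v Hv]] /in_max[k [w Hw]]].
  apply: npg; exists (m + k)%N; rewrite exprD.
  rewrite -(subrK (v * a) (g ^+ m)) -(subrK (w * b) (g ^+ k)).
  rewrite mulrDl; apply: idealD => //; first exact: idealMr.
  rewrite mulrDr; apply: idealD => //; first exact: idealM.
  by rewrite mulrACA; apply: idealM.
have npg1 : ~ p g by move=> pg; apply: npg; exists 1%N; rewrite expr1.
have [a na Ha] := prime_specialize pp npg1.
have [||c [c0 cg]] := Ha K idfun.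
- move=> b pb; apply/eqP/negPn/negP => b0; case: pp => _ + _; apply.
  by rewrite -mpolyC1 -(mulVf b0) mpolyCM; apply: idealM.
- by apply/eqP => /= a0; apply: na; rewrite a0 mpolyC0; apply: ideal0.
move/eqP: cg; apply; apply: vanish => q Iq; apply: c0; exact: Ip.
Qed.

End Nullstellensatz.

Section Transfer.
Variables (A K W : comNzRingType) (ev : {rmorphism A -> K}) (psi : {rmorphism A -> W}).
Hypothesis ker_psi : forall a, ev a = 0 -> psi a = 0.

Definition coefs (R : nzRingType) n (q : {mpoly R[n]}) := [seq q@_m | m <- msupp q].

Lemma lift_mpoly n (q : {mpoly K[n]}) :
  (forall a, a \in coefs q -> exists b, ev b = a) -> exists q', map_mpoly ev q' = q.
Proof.
move=> Hq; rewrite [q]mpolyE big_seq.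
apply: (big_ind (fun q => exists q', map_mpoly ev q' = q)).
- by exists 0; rewrite rmorph0.
- by move=> a b [a' <-] [b' <-]; exists (a' + b'); rewrite rmorphD.
- move=> m mq; have [|b Eb] := Hq q@_m; first by apply/mapP; exists m.
  by exists (b *: 'X_[m]); rewrite map_mpolyZ map_mpolyX Eb.
Qed.

Lemma mmap_ker n (q : {mpoly A[n]}) (x : 'I_n -> W) :
  map_mpoly ev q = 0 -> mmap psi x q = 0.
Proof.
move=> q0; rewrite /mmap big1_seq // => m _; rewrite ker_psi ?mul0r //.
by rewrite -mcoeff_map_mpoly q0 mcoeff0.
Qed.

End Transfer.

(** The image of [ev] stands for a subring of [K] containing [L], and the condition on kernels says
    that [psi] is a map from this subring to [W]. The implication from [e] to [g] then holds for
    points of [W]. *)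
Definition transfers (K : closedFieldType) n (e : seq {mpoly K[n]}) g (L : seq K) :=
  forall (A : comNzRingType) (W : idomainType) (ev : {rmorphism A -> K})
    (psi : {rmorphism A -> W}), (forall a, ev a = 0 -> psi a = 0) ->
    (forall a, a \in L -> exists b, ev b = a) ->
    forall (e' : seq {mpoly A[n]}) g', map (map_mpoly ev) e' = e -> map_mpoly ev g' = g ->
    forall x : 'I_n -> W, (forall q, q \in e' -> mmap psi x q = 0) -> mmap psi x g' = 0.

(* The coefficients of a Nullstellensatz certificate make up [L]. *)
Lemma transfer (K : closedFieldType) n (e : seq {mpoly K[n]}) (g : {mpoly K[n]}) :
  (forall c, (forall q, q \in e -> q.@[c] = 0) -> g.@[c] = 0) -> exists L, transfers e g L.
Proof.
move=> vanish.
have [|m [c Ec]] := nullstellensatz (span_ideal e) (g := g).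
  by move=> x Hx; apply: vanish => q /mem_span; apply: Hx.
exists (flatten [seq coefs (c i) | i <- iota 0 (size e)]).
move=> A W ev psi ker Hlift e' g' Ee' Eg' x Hx.
have /choice[c' Ec'] : forall i, exists q, (i < size e)%N -> map_mpoly ev q = c i.
  move=> i; have [ilt|] := boolP (i < size e)%N; last by exists 0.
  have [|q <-] := @lift_mpoly _ _ ev _ (c i); last by exists q.
  move=> a ai; apply: Hlift; apply/flattenP; exists (coefs (c i)) => //.
  by apply/mapP; exists i => //; rewrite mem_iota.
have se : size e' = size e by rewrite -Ee' size_map.
have : mmap psi x (g' ^+ m - \sum_(i < size e') c' i * e'`_i) = 0.
  apply: (mmap_ker ker); rewrite rmorphB rmorphXn /= Eg' Ec rmorph_sum se.
  apply/eqP; rewrite subr_eq0; apply/eqP; apply: eq_bigr => i _.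
  rewrite rmorphM /= Ec' //; congr (_ * _).
  have : (i < size e')%N by rewrite se.
  by move=> /(nth_map 0 0 (map_mpoly ev)); rewrite Ee'.
rewrite rmorphB rmorphXn /= rmorph_sum big1 ?subr0 => [/eqP|i _].
  by rewrite expf_eq0 => /andP[_ /eqP].
by rewrite rmorphM /= (Hx e'`_i) ?mulr0 // mem_nth.
Qed.

Section Frobenius.
Variables (p : nat) (W : closedFieldType).
Hypothesis charW : p \in [pchar W].

Lemma frobeniusD s (x y : W) : (x + y) ^+ (p ^ s) = x ^+ (p ^ s) + y ^+ (p ^ s).
Proof. by apply: exprDn_pchar; rewrite pnatX orbC (pnatE _ (pcharf_prime charW)) charW orbT. Qed.

Lemma frobenius_period s t (w : W) : w ^+ (p ^ s) = w -> w ^+ (p ^ (s * t)) = w.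
Proof. by move=> ws; elim: t => [|t IHt]; rewrite ?muln0 // mulnS expnD exprM ws. Qed.

Lemma frobenius_int s (m : int) : (m%:~R : W) ^+ (p ^ s) = m%:~R.
Proof.
have p0 : (0 < p ^ s)%N by rewrite expn_gt0 prime_gt0 ?(pcharf_prime charW).
have Hn k : (k%:R : W) ^+ (p ^ s) = k%:R.
  elim: k => [|k IHk]; first by rewrite expr0n eqn0Ngt p0.
  by rewrite -addn1 natrD frobeniusD IHk expr1n.
case: m => k; first exact: Hn.
rewrite NegzE rmorphN /= -pmulrn; apply/eqP; rewrite -subr_eq0 opprK -{2}(Hn k.+1).
by rewrite -frobeniusD addNr expr0n eqn0Ngt p0.
Qed.

End Frobenius.

(** The Frobenius iterates of [w] are roots of one polynomial over the prime field, so two of them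
    coincide; the Frobenius being injective, the earlier one can be moved back to [w]. *)
Lemma closure_Fp p : prime p -> exists2 W : closedFieldType, p \in [pchar W] &
  forall w : W, exists2 s, (0 < s)%N & w ^+ (p ^ s) = w.
Proof.
move=> pp; have [W [phi Hphi]] := countable_algebraic_closure 'F_p.
have charW : p \in [pchar W] by rewrite (rmorph_pchar phi) // pchar_Fp.
exists W => // w; have [q mq rq] := Hphi w.
have Frob x : (map_poly phi q).[x] ^+ p = (map_poly phi q).[x ^+ p].
  elim/poly_ind: (q) => [|r c IHr].
    by rewrite rmorph0 !horner0 expr0n eqn0Ngt prime_gt0.
  rewrite rmorphD rmorphM /= map_polyX map_polyC !hornerE.
  have := frobeniusD charW 1; rewrite expn1 => ->.
  have cp : c ^+ p = c by have := expf_card c; rewrite card_Fp.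
  by rewrite exprMn IHr -rmorphXn /= cp.
have Q0 : map_poly phi q != 0 by rewrite map_poly_eq0 monic_neq0.
pose rs := [seq w ^+ (p ^ i) | i <- iota 0 (size (map_poly phi q))].
have root_rs : all (root (map_poly phi q)) rs.
  apply/allP => _ /mapP[i _ ->]; elim: i => [|i IHi]; first by rewrite expn0 expr1.
  by rewrite expnSr exprM /root -Frob (eqP IHi) expr0n eqn0Ngt prime_gt0.
have : ~~ uniq rs.
  by apply/negP => /(max_poly_roots Q0 root_rs); rewrite size_map size_iota ltnn.
case/(uniqPn 0) => i [j [ij]]; rewrite size_map size_iota => js.
have is_ := ltn_trans ij js; rewrite !(nth_map 0) ?size_iota // !nth_iota // !add0n => E.
exists (j - i)%N; first by rewrite subn_gt0.
set v := w ^+ _; apply/eqP; rewrite -subr_eq0.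
have := frobeniusD charW i w (v - w); rewrite addrC subrK -exprM -expnD subnK ?(ltnW ij) //.
rewrite -E -[X in X = _]addr0 => /addrI/esym/eqP.
by rewrite expf_eq0 => /andP[].
Qed.

(* [A] is a polynomial ring over the integers, [ev] evaluates at [L], and [psi] is obtained from
   [prime_specialize] over the algebraic closure of a large prime field. *)
Lemma finite_spread (K : numClosedFieldType) (L : seq K) :
  exists (A : comNzRingType) (W : closedFieldType) (ev : {rmorphism A -> K})
    (psi : {rmorphism A -> W}) (G : seq W),
  [/\ forall a, ev a = 0 -> psi a = 0, forall a, a \in L -> exists b, ev b = a,
      forall a, psi a \in G &
      forall u v, u \in G -> v \in G -> (u + v \in G) /\ (u * v \in G)].
Proof.
pose k := size L; pose ev : {rmorphism {mpoly int[k]} -> K} := mmap intr (fun i : 'I_k => L`_i).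
pose P a := ev a = 0.
have pP : is_prime P.
  split; [split| |] => [|a b Ha Hb|a b Hb||a b].
  - exact: rmorph0.
  - by rewrite /P rmorphD Ha Hb addr0.
  - by rewrite /P rmorphM Hb mulr0.
  - by rewrite /P rmorph1; apply/eqP/oner_neq0.
  - by rewrite /P rmorphM => /eqP; rewrite mulf_eq0 => /orP[] /eqP; [left|right].
have [_ P1 _] := pP.
(* With [g = 1] only a specialization is requested; the characteristics to avoid are the divisors of
   [a], so a prime above its absolute value is safe. *)
have [a na Ha] := prime_specialize pP P1.
have a0 : a != 0 by apply/eqP => a0; apply: na; rewrite a0 mpolyC0; apply: rmorph0.
have [p pa pp] := prime_above `|a|.
have [W charW finW] := closure_Fp pp.
have [||c [c0 _]] := Ha W intr.
- move=> b; rewrite /P /ev /= mmapC => /eqP; rewrite intr_eq0 => /eqP->.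
  by rewrite rmorph0.
- rewrite -[a]intz [a]intEsign !intz /= rmorphM rmorph_sign mulf_neq0 ?signr_eq0 //=.
  rewrite -pmulrn -(dvdn_pcharf charW) gtnNdvd ?absz_gt0 //.
have [s s0 cs] : exists2 s, (0 < s)%N & forall i, c i ^+ (p ^ s) = c i.
  have /choice[t Ht] : forall i, exists s, (0 < s)%N /\ c i ^+ (p ^ s) = c i.
    by move=> i; have [s] := finW (c i); exists s.
  exists (\prod_i t i)%N; first by rewrite prodn_gt0 // => i; case: (Ht i).
  by move=> i; rewrite (bigD1 i) //=; apply: frobenius_period; case: (Ht i).
set psi : {rmorphism {mpoly int[k]} -> W} := mmap intr c.
(* The roots [G] of [f] form the subfield of [W] with [q] elements. It contains every [c i], because
   [s] is a common multiple of their Frobenius periods. *)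
set q := (p ^ s)%N in cs; pose f : {poly W} := 'X^q - 'X.
have q1 : (1 < q)%N by rewrite -(expn0 p) ltn_exp2l ?prime_gt1.
have sf : size f = q.+1.
  by rewrite size_polyDl size_polyXn // size_polyN size_polyX ltnS.
have f0 : f != 0 by rewrite -size_poly_eq0 sf.
have [G EG] := closed_field_poly_normal f.
have memG w : (w \in G) = (w ^+ q == w).
  rewrite -root_prod_XsubC -(rootZ _ _ (_ : lead_coef f != 0)) ?lead_coef_eq0 // -EG.
  by rewrite /root !hornerE ?hornerXn subr_eq0.
exists {mpoly int[k]}, W, ev, psi, G; split=> //.
- move=> b /(nthP 0)[i ik <-]; exists 'X_(Ordinal ik).
  by rewrite /ev /= mmapX mmap1U.
- move=> b; rewrite memG [b]mpolyE rmorph_sum.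
  apply: (big_ind (fun w : W => w ^+ q == w)).
  + by rewrite expr0n eqn0Ngt (ltnW q1).
  + by move=> x y /eqP Hx /eqP Hy; rewrite frobeniusD // Hx Hy.
  + move=> m _; rewrite /psi /= mmapZ mmapX exprMn frobenius_int //.
    rewrite /mmap1 -prodrXl; apply/eqP; congr (_ * _); apply: eq_bigr => i _.
    by rewrite exprAC cs.
- move=> u v; rewrite !memG => /eqP Hu /eqP Hv.
  by rewrite frobeniusD // exprMn Hu Hv !eqxx.
Qed.

(** The points of [E] with coordinates in [G] are finite in number and are permuted by [f], whose
    coefficients are in [G]. *)
Lemma finite_ax (A : comNzRingType) (W : closedFieldType) (psi : {rmorphism A -> W}) (G : seq W)
    n (e : seq {mpoly A[n]}) (F : 'I_n -> {mpoly A[n]}) :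
  (forall a, psi a \in G) ->
  (forall u v, u \in G -> v \in G -> (u + v \in G) /\ (u * v \in G)) ->
  let E (x : 'I_n -> W) := forall q, q \in e -> mmap psi x q = 0 in
  let f (x : 'I_n -> W) i := mmap psi x (F i) in
  (forall x, E x -> E (f x)) ->
  (forall x x', E x -> E x' -> f x = f x' -> x = x') ->
  forall y, (forall i, y i \in G) -> E y -> exists2 x, E x & f x = y.
Proof.
move=> psiG GDM E f fE fI y yG Ey.
have evG (x : 'I_n -> W) q : (forall i, x i \in G) -> mmap psi x q \in G.
  move=> xG; have G1 : 1 \in G by rewrite -(rmorph1 psi).
  rewrite [q]mpolyE rmorph_sum; apply: (big_ind (fun w => w \in G)).
  - by rewrite -(rmorph0 psi).
  - by move=> u v uG vG; case: (GDM u v).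
  - move=> m _; rewrite /= mmapZ mmapX; have := GDM (psi q@_m) (mmap1 x m); case=> //.
    rewrite /mmap1; apply: (big_ind (fun w => w \in G)) => // [u v uG vG|i _].
      by case: (GDM u v).
    elim: (m i) => [|k IHk]; first by rewrite expr0.
    by rewrite exprS; case: (GDM _ _ (xG i) IHk).
pose T := {ffun 'I_n -> seq_sub G}.
pose pt (x : T) i := val (x i) : W.
have ptG x i : pt x i \in G by apply: ssvalP.
pose g (x : T) : T := [ffun i => SeqSub (evG (pt x) (F i) (ptG x))].
have ptg x : pt (g x) = f (pt x) by apply/funext => i; rewrite /pt ffunE.
pose S := [set x : T | all (fun q => mmap psi (pt x) q == 0) e].
have inS x : x \in S <-> E (pt x).
  rewrite inE; split=> [/allP H q /H/eqP//|H]; apply/allP => q qe.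
  by rewrite H.
have pt_inj x x' : pt x = pt x' -> x = x'.
  by move=> H; apply/ffunP => i; apply: val_inj; have := congr1 (fun h => h i) H.
have gS : g @: S = S.
  apply/eqP; rewrite eqEcard card_in_imset ?leqnn ?andbT.
    apply/subsetP => _ /imsetP[x /inS Ex ->]; apply/inS; rewrite ptg; exact: fE.
  move=> x x' /inS Ex /inS Ex' gx; apply: pt_inj; apply: fI => //.
  by rewrite -!ptg gx.
pose yT : T := [ffun i => SeqSub (yG i)].
have pty : pt yT = y by apply/funext => i; rewrite /pt ffunE.
have : yT \in S by apply/inS; rewrite pty.
rewrite -gS => /imsetP[x /inS Ex Eyx]; exists (pt x) => //.
by rewrite -ptg -Eyx.
Qed.

(** If [y] had no preimage, stability of [E], injectivity on [E] and inconsistency of the equations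
    of a preimage would all have certificates with coefficients in a finite list [L]. Carried to [W]
    by [finite_spread], the first two allow [finite_ax] to produce a preimage of the image of [y],
    which the third forbids. *)
Theorem ax_surjective (K : numClosedFieldType) n (J : {mpoly K[n]} -> Prop) (F : 'I_n -> {mpoly K[n]}) :
  let E (x : 'I_n -> K) := forall q, J q -> q.@[x] = 0 in
  let f (x : 'I_n -> K) i := (F i).@[x] in
  (forall x, E x -> E (f x)) ->
  (forall x x', E x -> E x' -> f x = f x' -> x = x') ->
  forall y, E y -> exists2 x, E x & f x = y.
Proof.
move=> E f fE fI y Ey; apply: contrapT => ny.
have [e eE egen] := mpoly_noetherian (vanishing_ideal E).
have Ve x : (forall q, q \in e -> q.@[x] = 0) -> E x.
  move=> Hx q Jq; apply: (egen _ (point_ideal x)) => //.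
  by move=> x' Ex'; apply: Ex'.
pose sub (R : comNzRingType) m (h : 'I_n -> {mpoly R[m]}) : {mpoly R[n]} -> {mpoly R[m]} :=
  mmap (@mpolyC m R) h.
have sub_mmap (R S : comNzRingType) m (h : 'I_n -> {mpoly R[m]}) (psi : {rmorphism R -> S}) x q :
    mmap psi x (sub R m h q) = mmap psi (fun i => mmap psi x (h i)) q.
  exact: (mmap_comp idfun psi).
have sub_eval m (h : 'I_n -> {mpoly K[m]}) x q : (sub K m h q).@[x] = q.@[fun i => (h i).@[x]].
  exact: sub_mmap.
have map_sub (A : comNzRingType) (ev : {rmorphism A -> K}) m h h' q :
    (forall i, map_mpoly ev (h i) = h' i) ->
    map_mpoly ev (sub A m h q) = sub K m h' (map_mpoly ev q).
  move=> hh'.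
  apply: (mpoly_rmorph_eq (f := map_mpoly ev \o mmap (@mpolyC m A) h)
    (g := mmap (@mpolyC m K) h' \o map_mpoly ev)) => [c|i] /=.
    by rewrite mmapC !map_mpolyC mmapC.
  by rewrite mmapX mmap1U map_mpolyX mmapX mmap1U.
(* Injectivity is an implication in [n + n] variables: [hl] and [hr] are the coordinates of two
   points, [e2] says that both lie in [E] and have the same image. The system [e3] describes a
   preimage of [y]. All are defined over any ring, since they are needed over [A] and over [K]. *)
pose hl (R : comNzRingType) (i : 'I_n) : {mpoly R[n + n]} := 'X_(lshift n i).
pose hr (R : comNzRingType) (i : 'I_n) : {mpoly R[n + n]} := 'X_(rshift n i).
pose e2 (R : comNzRingType) (e : seq {mpoly R[n]}) (F : 'I_n -> {mpoly R[n]}) :=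
  map (sub R _ (hl R)) e ++ map (sub R _ (hr R)) e ++
  [seq sub R _ (hl R) (F i) - sub R _ (hr R) (F i) | i <- enum 'I_n].
pose e3 (R : comNzRingType) (e : seq {mpoly R[n]}) F (y : 'I_n -> R) :=
  e ++ [seq F i - (y i)%:MP | i <- enum 'I_n].
have /choice[L1 HL1] : forall j, exists L, (j < size e)%N -> transfers e (sub K n F e`_j) L.
  move=> j; have [je|] := boolP (j < size e)%N; last by exists [::].
  have [|L HL] := @transfer K n e (sub K n F e`_j); last by exists L.
  by move=> c /Ve Ec; rewrite sub_eval; apply: eE (mem_nth _ je) _ (fE _ Ec).
have mem_catl (T : eqType) (s1 s2 : seq T) a : a \in s1 -> a \in s1 ++ s2.
  by move=> as1; rewrite mem_cat as1.
have mem_catr (T : eqType) (s1 s2 : seq T) a : a \in s2 -> a \in s1 ++ s2.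
  by move=> as2; rewrite mem_cat as2 orbT.
have /choice[L2 HL2] : forall i, exists L, transfers (e2 K e F) (hl K i - hr K i) L.
  move=> i; apply: (@transfer K) => c Hc.
  have Hl : E (fun i => c (lshift n i)).
    apply: Ve => q qe; have := map_f (sub K _ (hl K)) qe.
    move=> /(fun H => Hc _ (mem_catl _ _ _ _ H)).
    rewrite sub_eval => E0; rewrite -[RHS]E0.
    by apply: meval_eq => j; rewrite /hl mevalXU.
  have Hr : E (fun i => c (rshift n i)).
    apply: Ve => q qe; have := map_f (sub K _ (hr K)) qe.
    move=> /(fun H => Hc _ (mem_catr _ _ _ _ (mem_catl _ _ _ _ H))).
    rewrite sub_eval => E0; rewrite -[RHS]E0.
    by apply: meval_eq => j; rewrite /hr mevalXU.
  rewrite mevalB !mevalXU; apply/eqP; rewrite subr_eq0; apply/eqP.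
  have := fI _ _ Hl Hr => /(_ _)/(congr1 (fun h => h i)); apply.
  apply/funext => j; apply/eqP; rewrite -subr_eq0; apply/eqP.
  rewrite -(Hc (sub K _ (hl K) (F j) - sub K _ (hr K) (F j))); last first.
    by rewrite !mem_cat; apply/or3P/Or33/mapP; exists j; rewrite ?mem_enum.
  rewrite mevalB !sub_eval; congr (_ - _); apply: meval_eq => k;
    by rewrite /hl /hr mevalXU.
have [L3 HL3] : exists L, transfers (e3 K e F y) 1 L.
  apply: (@transfer K) => c Hc; case: ny; exists c.
    by apply: Ve => q qe; apply: Hc; rewrite mem_cat qe.
  apply/funext => i; apply/eqP; rewrite -subr_eq0; apply/eqP.
  rewrite -(Hc (F i - (y i)%:MP)) ?mevalB ?mevalC //.
  by rewrite mem_cat; apply/orP; right; apply/mapP; exists i; rewrite ?mem_enum.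
pose L := flatten [seq L1 j | j <- iota 0 (size e)] ++ flatten [seq L2 i | i <- enum 'I_n] ++
  L3 ++ flatten [seq coefs q | q <- e] ++ flatten [seq coefs (F i) | i <- enum 'I_n] ++
  [seq y i | i <- enum 'I_n].
have [A [W [ev [psi [G [ker HL psiG GDM]]]]]] := finite_spread L.
have inL (T : eqType) (l : T -> seq K) s x a : x \in s -> a \in l x -> a \in flatten (map l s).
  by move=> xs ax; apply/flattenP; exists (l x) => //; apply: map_f.
have HL1' j : (j < size e)%N -> forall a, a \in L1 j -> exists b, ev b = a.
  by move=> je a aL; apply: HL; rewrite mem_cat (inL _ _ _ j) // mem_iota.
have HL2' i a : a \in L2 i -> exists b, ev b = a.
  by move=> aL; apply: HL; rewrite !mem_cat (inL _ _ (enum 'I_n) i) ?orbT // mem_enum.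
have HL3' a : a \in L3 -> exists b, ev b = a.
  by move=> aL; apply: HL; rewrite !mem_cat aL ?orbT.
have [e' Ee'] : exists e', map (map_mpoly ev) e' = e.
  have He q a : q \in e -> a \in coefs q -> exists b, ev b = a.
    by move=> qe aq; apply: HL; rewrite !mem_cat (inL _ (@coefs _ _) e q) ?orbT.
  elim: (e) He => [|q s IHs] He; first by exists [::].
  have [|q' Eq'] := @lift_mpoly _ _ ev _ q; first by move=> a; apply: He; rewrite mem_head.
  have [|s' Es'] := IHs; first by move=> r a rs; apply: He; rewrite inE rs orbT.
  by exists (q' :: s'); rewrite /= Eq' Es'.
have /choice[F' EF'] : forall i, exists q, map_mpoly ev q = F i.
  move=> i; apply: lift_mpoly => a aF.
  by apply: HL; rewrite !mem_cat (inL _ (fun i => coefs (F i)) (enum 'I_n) i) ?orbT ?mem_enum.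
have /choice[y' Ey'] : forall i, exists a, ev a = y i.
  by move=> i; apply: HL; rewrite !mem_cat map_f ?orbT ?mem_enum.
have se : size e' = size e by rewrite -Ee' size_map.
have e'j j : (j < size e)%N -> map_mpoly ev e'`_j = e`_j.
  by rewrite -se => je; rewrite -Ee' (nth_map 0).
have mapl i : map_mpoly ev (hl A i) = hl K i by rewrite /hl map_mpolyX.
have mapr i : map_mpoly ev (hr A i) = hr K i by rewrite /hr map_mpolyX.
have [||||x Ex fx] := @finite_ax A W psi G n e' F' psiG GDM _ _ (fun i => psi (y' i)).
- move=> x Ex q /(nthP 0)[j]; rewrite se => je <-; rewrite -sub_mmap.
  apply: (HL1 j je A W ev psi ker (HL1' j je) e') => //.
  by rewrite (map_sub _ _ _ _ F) // e'j.
- move=> x x' Ex Ex' fxx'; apply/funext => i; apply/eqP; rewrite -subr_eq0; apply/eqP.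
  pose z (i : 'I_(n + n)) := match split i with inl j => x j | inr j => x' j end.
  have zl : (fun i => mmap psi z (hl A i)) = x.
    apply/funext => j; rewrite /hl mmapX mmap1U /z.
    by rewrite (unsplitK (inl j)).
  have zr : (fun i => mmap psi z (hr A i)) = x'.
    apply/funext => j; rewrite /hr mmapX mmap1U /z.
    by rewrite (unsplitK (inr j)).
  rewrite -[in LHS]zl -[in LHS]zr -rmorphB.
  apply: (HL2 i A W ev psi ker (HL2' i) (e2 A e' F')) => [||q].
  + rewrite /e2 !map_cat -Ee' -!map_comp; congr (_ ++ (_ ++ _)); apply: eq_map => q /=.
    * exact: map_sub.
    * exact: map_sub.
    * by rewrite rmorphB /= !(map_sub _ _ _ _ _ _ mapl, map_sub _ _ _ _ _ _ mapr) EF'.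
  + by rewrite rmorphB /= mapl mapr.
  + rewrite !mem_cat => /or3P[] /mapP[r re ->]; rewrite ?rmorphB /= ?sub_mmap ?zl ?zr.
    * exact: Ex.
    * exact: Ex'.
    * by have /(congr1 (fun h => h r)) := fxx'; move=> ->; rewrite subrr.
- by move=> i; apply: psiG.
- move=> q /(nthP 0)[j]; rewrite se => je <-.
  have -> : mmap psi (fun i => psi (y' i)) e'`_j = psi (mmap idfun y' e'`_j).
    symmetry.
    apply: (mpoly_rmorph_eq (f := psi \o mmap idfun y') (g := mmap psi (fun i => psi (y' i))))
      => [c|i] /=; first by rewrite !mmapC.
    by rewrite !mmapX !mmap1U.
  apply: ker.
  have -> : ev (mmap idfun y' e'`_j) = (map_mpoly ev e'`_j).@[y].
    apply: (mpoly_rmorph_eq (f := ev \o mmap idfun y') (g := meval y \o map_mpoly ev))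
      => [c|i] /=; first by rewrite mmapC map_mpolyC mevalC.
    by rewrite mmapX mmap1U map_mpolyX mevalXU.
  by rewrite e'j //; apply: eE (mem_nth _ je) _ Ey.
have : mmap psi x 1 = 0.
  apply: (HL3 A W ev psi ker HL3' (e3 A e' F' y')) => [||q].
  - rewrite /e3 map_cat -Ee' -!map_comp; congr (_ ++ _); apply: eq_map => i /=.
    rewrite rmorphB /= EF' map_mpolyC; congr (_ - _%:MP).
    exact: Ey'.
  - exact: rmorph1.
  - rewrite mem_cat => /orP[/Ex//|/mapP[i _ ->]].
    by rewrite rmorphB /= mmapC; have /(congr1 (fun h => h i)) := fx; move=> ->; rewrite subrr.
by rewrite rmorph1 => /eqP; rewrite oner_eq0.
Qed.

(** * Constructible sets *)

Section Constructible.
Variable K : closedFieldType.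

Inductive constructible n : (('I_n -> K) -> Prop) -> Prop :=
| constr_zero (p : {mpoly K[n]}) : constructible (fun x => p.@[x] = 0)
| constr_and U V : constructible U -> constructible V -> constructible (fun x => U x /\ V x)
| constr_not U : constructible U -> constructible (fun x => ~ U x)
| constr_iff U V : (forall x, U x <-> V x) -> constructible U -> constructible V.

Lemma constr_or n (U V : ('I_n -> K) -> Prop) :
  constructible U -> constructible V -> constructible (fun x => U x \/ V x).
Proof.
move=> cU cV; apply: (constr_iff (U := fun x => ~ (~ U x /\ ~ V x))) => [x|].
  by rewrite -not_orE notK.
by apply: constr_not; apply: constr_and; apply: constr_not.
Qed.

Lemma constr_all n (T : eqType) (s : seq T) (U : T -> ('I_n -> K) -> Prop) :
  (forall a, constructible (U a)) -> constructible (fun x => forall a, a \in s -> U a x).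
Proof.
move=> cU; elim: s => [|a s IHs].
  by apply: (constr_iff (U := fun x => (0 : {mpoly K[n]}).@[x] = 0)) => [x|];
    [rewrite meval0|exact: constr_zero].
apply: (constr_iff (U := fun x => U a x /\ forall b, b \in s -> U b x)) => [x|].
  split=> [[Ua Us] b|H]; first by rewrite inE => /predU1P[->|/Us].
  by split=> [|b bs]; apply: H; rewrite inE ?eqxx ?bs ?orbT.
exact: constr_and.
Qed.

Lemma constr_pull n m (F : 'I_m -> {mpoly K[n]}) (U : ('I_m -> K) -> Prop) :
  constructible U -> constructible (fun x => U (fun i => (F i).@[x])).
Proof.
elim=> {U} [p|U V _ cU _ cV|U _ cU|U V UV _ cU].
- apply: (constr_iff (U := fun x => (mmap (@mpolyC n K) F p).@[x] = 0)) => [x|].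
    by have -> : (mmap (@mpolyC n K) F p).@[x] = p.@[fun i => (F i).@[x]]
      by exact: (mmap_comp idfun idfun).
  exact: constr_zero.
- exact: constr_and.
- exact: constr_not.
- by apply: constr_iff cU => x; apply: UV.
Qed.

(** The generic point of the variety of [p] decides membership in [U]; as [p] is prime, the
    exceptional hypersurfaces met along the construction of [U] can be multiplied together. *)
Lemma constr_generic n (p : {mpoly K[n]} -> Prop) U : is_prime p -> constructible U ->
  exists2 g, ~ p g &
    (forall x, (forall q, p q -> q.@[x] = 0) -> g.@[x] != 0 -> U x) \/
    (forall x, (forall q, p q -> q.@[x] = 0) -> g.@[x] != 0 -> ~ U x).
Proof.
move=> pp; elim=> {U} [q|U V _ [g ng Ug] _ [h nh Vh]|U _ [g ng Ug]|U V UV _ [g ng Ug]].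
- case: (pselect (p q)) => [pq|npq].
    by exists 1; [case: pp|left => x Hx _; apply: Hx].
  by exists q => //; right => x _ /eqP.
- have ngh : ~ p (g * h) by case: pp => _ _ pM /pM[].
  exists (g * h) => //.
  case: Ug => [Ug|Ug]; last first.
    by right=> x Hx; rewrite mevalM mulf_eq0 negb_or => /andP[gx _] [Ux _]; apply: Ug gx Ux.
  case: Vh => [Vh|Vh]; last first.
    by right=> x Hx; rewrite mevalM mulf_eq0 negb_or => /andP[_ hx] [_ Vx]; apply: Vh hx Vx.
  left=> x Hx; rewrite mevalM mulf_eq0 negb_or => /andP[gx hx].
  by split; [apply: Ug|apply: Vh].
- exists g => //; case: Ug => Ug; [right|left] => // x Hx gx nUx.
  by apply: nUx; apply: Ug.
- exists g => //; case: Ug => Ug; [left|right] => x Hx gx.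
    by apply/UV; apply: Ug.
  by move/UV; apply: Ug.
Qed.

Definition env n (x : 'I_n -> K) : seq K := [seq x i | i <- enum 'I_n].

Lemma size_env n (x : 'I_n -> K) : size (env x) = n.
Proof. by rewrite size_map size_enum_ord. Qed.

Lemma nth_env n (x : 'I_n -> K) (i : 'I_n) : (env x)`_i = x i.
Proof. by rewrite (nth_map i) ?size_enum_ord // nth_ord_enum. Qed.

Lemma env_surj n (e : seq K) : size e = n -> exists x : 'I_n -> K, env x = e.
Proof.
move=> se; exists (fun i => e`_i); apply: (@eq_from_nth _ 0); first by rewrite size_env.
by move=> i; rewrite size_env => ilt; rewrite (nth_env _ (Ordinal ilt)).
Qed.

Definition mnm_term n (m : 'X_{1..n}) : GRing.term K :=
  foldr (fun (i : 'I_n) t => GRing.Mul (GRing.Exp (GRing.Var K i) (m i)) t)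
    (GRing.Const 1) (enum 'I_n).

Definition mpoly_term n (p : {mpoly K[n]}) : GRing.term K :=
  foldr (fun m t => GRing.Add (GRing.Mul (GRing.Const p@_m) (mnm_term m)) t)
    (GRing.Const 0) (msupp p).

Lemma mpoly_termP n (p : {mpoly K[n]}) x : GRing.eval (env x) (mpoly_term p) = p.@[x].
Proof.
rewrite mevalE /mpoly_term; elim: (msupp p) => [|m s IHs]; first by rewrite big_nil.
rewrite big_cons /= IHs; congr (_ * _ + _).
rewrite -big_enum /mnm_term; elim: (enum 'I_n) => [|i r IHr]; first by rewrite big_nil.
by rewrite big_cons /= IHr nth_env.
Qed.

Lemma constr_formula n (U : ('I_n -> K) -> Prop) : constructible U ->
  exists phi : GRing.formula K, forall x, U x <-> GRing.holds (env x) phi.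
Proof.
elim=> {U} [p|U V _ [phi Hphi] _ [psi Hpsi]|U _ [phi Hphi]|U V UV _ [phi Hphi]].
- by exists (GRing.Equal (mpoly_term p) (GRing.Const 0)) => x /=; rewrite mpoly_termP.
- by exists (GRing.And phi psi) => x /=; rewrite Hphi Hpsi.
- by exists (GRing.Not phi) => x /=; rewrite Hphi.
- by exists phi => x; rewrite -UV.
Qed.

Lemma term_mpoly n (t : GRing.term K) : GRing.rterm t ->
  exists p : {mpoly K[n]}, forall x, GRing.eval (env x) t = p.@[x].
Proof.
elim: t => //= [i|c|k|t1 IH1 t2 IH2|t IHt|t IHt k|t1 IH1 t2 IH2|t IHt k].
- have [ilt|ige] := ltnP i n => _.
    exists 'X_(Ordinal ilt) => x; rewrite mevalXU.
    by rewrite -(nth_env x (Ordinal ilt)).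
  by exists 0 => x; rewrite meval0 nth_default // size_env.
- by move=> _; exists c%:MP => x; rewrite mevalC.
- by move=> _; exists k%:R => x; rewrite rmorph_nat.
- by case/andP => /IH1[p Hp] /IH2[q Hq]; exists (p + q) => x; rewrite mevalD Hp Hq.
- by case/IHt => p Hp; exists (- p) => x; rewrite mevalN Hp.
- by case/IHt => p Hp; exists (p *+ k) => x; rewrite mevalMn Hp.
- by case/andP => /IH1[p Hp] /IH2[q Hq]; exists (p * q) => x; rewrite mevalM Hp Hq.
- by case/IHt => p Hp; exists (p ^+ k) => x; rewrite rmorphXn /= Hp.
Qed.

Lemma qf_constr n (f : GRing.formula K) : GRing.qf_form f -> GRing.rformula f ->
  constructible (fun x : 'I_n -> K => GRing.qf_eval (env x) f).
Proof.
elim: f => //= [b|t1 t2|f IHf g IHg|f IHf g IHg|f IHf g IHg|f IHf].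
- move=> _ _; apply: (constr_iff (U := fun x => ((~~ b)%:R%:MP_[n] : {mpoly K[n]}).@[x] = 0)) => [x|].
    by rewrite mevalC; case: b; split=> // /eqP; rewrite oner_eq0.
  exact: constr_zero.
- move=> _ /andP[/(@term_mpoly n)[p Hp] /(@term_mpoly n)[q Hq]].
  apply: (constr_iff (U := fun x => (p - q).@[x] = 0)) => [x|]; last exact: constr_zero.
  by rewrite Hp Hq mevalB; split=> [/eqP|/eqP ->]; rewrite ?subr_eq0 ?subrr.
- move=> /andP[qf qg] /andP[rf rg].
  apply: (constr_iff (U := fun x => GRing.qf_eval (env x) f /\ GRing.qf_eval (env x) g)) => [x|].
    by split=> /andP.
  by apply: constr_and; [apply: IHf|apply: IHg].
- move=> /andP[qf qg] /andP[rf rg].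
  apply: (constr_iff (U := fun x => GRing.qf_eval (env x) f \/ GRing.qf_eval (env x) g)) => [x|].
    by split=> /orP.
  by apply: constr_or; [apply: IHf|apply: IHg].
- move=> /andP[qf qg] /andP[rf rg].
  apply: (constr_iff (U := fun x => ~ GRing.qf_eval (env x) f \/ GRing.qf_eval (env x) g)) => [x|].
    rewrite implybE; split=> [[/negP->|->]//|/orP[/negP|]]; first by rewrite orbT.
      by left.
    by right.
  by apply: constr_or; [apply: constr_not; apply: IHf|apply: IHg].
- move=> qf rf; apply: (constr_iff (U := fun x => ~ GRing.qf_eval (env x) f)) => [x|].
    by split=> /negP.
  by apply: constr_not; apply: IHf.
Qed.

Lemma formula_constr n (phi : GRing.formula K) :
  constructible (fun x : 'I_n -> K => GRing.holds (env x) phi).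
Proof.
have clK := @solve_monicpoly K.
pose psi := GRing.quantifier_elim (@ClosedFieldQE.ex_elim K) (GRing.to_rform phi).
have wf : GRing.wf_QE_proj (@ClosedFieldQE.ex_elim K) := @ClosedFieldQE.wf_ex_elim K.
have /andP[qpsi rpsi] : GRing.qf_form psi && GRing.rformula psi.
  by apply: (GRing.quantifier_elim_wf wf); exact: GRing.to_rform_rformula.
apply: (constr_iff _ (qf_constr n qpsi rpsi)) => x.
have P := GRing.quantifier_elim_rformP wf (ClosedFieldQE.holds_ex_elim clK) (env x)
  (GRing.to_rform_rformula phi).
by split=> [/P/GRing.to_rformP|/GRing.to_rformP/P].
Qed.

Lemma holds_exists m (e : seq K) phi :
  GRing.holds e (foldr (@GRing.Exists K) phi (iota (size e) m)) <->
  exists2 s, size s = m & GRing.holds (e ++ s) phi.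
Proof.
elim: m e => [|m IHm] e /=.
  split=> [H|[s /size0nil->]]; first by exists [::]; rewrite // cats0.
  by rewrite cats0.
split=> [[a]|[[|a s] // [sm] H]].
  rewrite (_ : set_nth _ _ _ _ = rcons e a); last first.
    by rewrite set_nthE ltnn subnn cats1.
  rewrite -(size_rcons e a) => /IHm[s sm H]; exists (a :: s); first by rewrite /= sm.
  by rewrite -cat_rcons.
exists a; rewrite (_ : set_nth _ _ _ _ = rcons e a); last first.
  by rewrite set_nthE ltnn subnn cats1.
rewrite -(size_rcons e a); apply/IHm; exists s => //.
by rewrite cat_rcons.
Qed.

(** Chevalley's theorem, read off from quantifier elimination: constructible sets are those defined
    by first-order formulas. *)
Lemma constr_exists n m (U : ('I_n -> K) -> ('I_m -> K) -> Prop) :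
  constructible (fun z : 'I_(n + m) -> K => U (fun i => z (lshift m i)) (fun i => z (rshift n i))) ->
  constructible (fun t => exists s, U t s).
Proof.
case/constr_formula => phi Hphi.
apply: constr_iff (formula_constr _ (foldr (@GRing.Exists K) phi (iota n m))) => t.
have envE t' s' : U t' s' <-> GRing.holds (env t' ++ env s') phi.
  pose z (i : 'I_(n + m)) := match split i with inl j => t' j | inr j => s' j end.
  have zl : (fun i => z (lshift m i)) = t'.
    by apply/funext => i; rewrite /z (unsplitK (inl i)).
  have zr : (fun i => z (rshift n i)) = s'.
    by apply/funext => i; rewrite /z (unsplitK (inr i)).
  suff -> : env t' ++ env s' = env z by rewrite -Hphi zl zr.
  apply: (@eq_from_nth _ 0) => [|i]; rewrite size_cat !size_env // => inm.
  rewrite (nth_env z (Ordinal inm)) nth_cat size_env /z; case: splitP => j /= ->.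
    by rewrite ltn_ord nth_env.
  by rewrite ltnNge leq_addr /= addKn nth_env.
have := holds_exists m (env t) phi; rewrite size_env => ->; split=> [[s sm H]|[s Us]].
  have [s' Es'] := env_surj sm; exists s'; apply/envE; by rewrite Es'.
by exists (env s); [rewrite size_env|apply/envE].
Qed.

Lemma constr_exists1 n (U : ('I_n.+1 -> K) -> Prop) : constructible U ->
  constructible (fun t => exists s, U (rcons_pt t s)).
Proof.
move=> cU; pose F (i : 'I_n.+1) : {mpoly K[n + 1]} :=
  if unlift ord_max i is Some j then 'X_(lshift 1 j) else 'X_(rshift n ord0).
have cz : constructible (fun z : 'I_(n + 1) -> K =>
    U (rcons_pt (fun i => z (lshift 1 i)) (z (rshift n ord0)))).
  apply: constr_iff (constr_pull F cU) => z.
  have -> : (fun i => (F i).@[z]) = rcons_pt (fun i => z (lshift 1 i)) (z (rshift n ord0)).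
    by apply/funext => i; rewrite /F /rcons_pt; case: unlift => [j|]; rewrite mevalXU.
  by [].
apply: constr_iff (constr_exists (U := fun t s => U (rcons_pt t (s ord0))) cz) => t.
by split=> [[s Us]|[s Us]]; [exists (s ord0)|exists (fun=> s)].
Qed.

End Constructible.

(** * Continuity of polynomials and of their roots *)

Section EuclideanTopology.
Variable K : numClosedFieldType.

Definition near n (e : K) (a x : 'I_n -> K) := forall i, `|x i - a i| < e.

Lemma near_le n (d e : K) (a x : 'I_n -> K) : d <= e -> near d a x -> near e a x.
Proof. by move=> de H i; apply: lt_le_trans (H i) de. Qed.

(** The order of [K] is partial; [d * e / (d + e)] is below both without a comparison. *)
Lemma min_pos (d e : K) : 0 < d -> 0 < e -> exists m : K, [/\ 0 < m, m <= d & m <= e].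
Proof.
move=> d0 e0; exists (d * e / (d + e)).
have de : 0 < d + e by apply: addr_gt0.
split; first by rewrite divr_gt0 ?mulr_gt0.
  by rewrite ler_pdivrMr // ler_pM2l // lerDr ltW.
by rewrite ler_pdivrMr // mulrC ler_pM2l // lerDl ltW.
Qed.

Lemma meval_continuous n (p : {mpoly K[n]}) a e : 0 < e ->
  exists2 d, 0 < d & forall x, near d a x -> `|p.@[x] - p.@[a]| < e.
Proof.
pose Q (p : {mpoly K[n]}) := forall e, 0 < e ->
  exists2 d, 0 < d & forall x, near d a x -> `|p.@[x] - p.@[a]| < e.
have QC c : Q c%:MP.
  by move=> e' e0; exists 1 => // x _; rewrite !mevalC subrr normr0.
have QX i : Q 'X_i by move=> e' e0; exists e' => // x /(_ i); rewrite !mevalXU.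
have QD q r : Q q -> Q r -> Q (q + r).
  move=> Hq Hr e' e0; have e2 : 0 < e' / 2 by rewrite divr_gt0.
  have [d1 d10 H1] := Hq _ e2; have [d2 d20 H2] := Hr _ e2.
  have [d [d0 dd1 dd2]] := min_pos d10 d20; exists d => // x Hx.
  rewrite !mevalD opprD addrACA (le_lt_trans (ler_normD _ _)) //.
  by rewrite [e']splitr ltrD // (H1, H2) //; apply: near_le Hx.
have QM q r : Q q -> Q r -> Q (q * r).
  move=> Hq Hr e' e0; set A := q.@[a]; set B := r.@[a].
  have A1 : 0 < `|A| + 1 by rewrite ltr_wpDl.
  have B1 : 0 < `|B| + 1 by rewrite ltr_wpDl.
  have e1 : 0 < e' / 2 / (`|B| + 1) by rewrite !divr_gt0.
  have e2 : 0 < e' / 2 / (`|A| + 1) by rewrite !divr_gt0.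
  have [d1 d10 H1] := Hq _ e1.
  have [d2 d20 H2] := Hr _ e2; have [d3 d30 H3] := Hr _ ltr01.
  have [d4 [d40 d41 d42]] := min_pos d10 d20.
  have [d [d0 dd4 dd3]] := min_pos d40 d30; exists d => // x Hx.
  have {}H1 := H1 x (near_le (le_trans dd4 d41) Hx).
  have {}H2 := H2 x (near_le (le_trans dd4 d42) Hx).
  have {}H3 := H3 x (near_le dd3 Hx).
  rewrite !mevalM -/A -/B in H1 H2 H3 *.
  have -> : q.@[x] * r.@[x] - A * B = (q.@[x] - A) * r.@[x] + A * (r.@[x] - B).
    by rewrite mulrBl mulrBr addrA subrK.
  rewrite (le_lt_trans (ler_normD _ _)) // !normrM [e']splitr ltrD //.
    have rx : `|r.@[x]| <= `|B| + 1.
      rewrite -[r.@[x]](subrK B) addrC (le_trans (ler_normD _ _)) //.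
      by rewrite lerD2l ltW.
    apply: le_lt_trans (ler_wpM2l (normr_ge0 _) rx) _.
    by rewrite -ltr_pdivlMr.
  apply: (@le_lt_trans _ _ ((`|A| + 1) * `|r.@[x] - B|)).
    by rewrite ler_wpM2r // lerDl.
  by rewrite mulrC -ltr_pdivlMr.
move: e; rewrite -/(Q p) [p]mpolyE; apply: (big_ind Q) => //.
  by rewrite -mpolyC0; apply: QC.
move=> m _; rewrite -mul_mpolyC mpolyXE_id; apply: (QM) => //.
apply: (big_ind Q) => // [|i _]; first by rewrite -mpolyC1; apply: QC.
by elim: (m i) => [|k IHk]; [rewrite expr0 -mpolyC1; apply: QC|rewrite exprS; apply: QM].
Qed.

Lemma coefs_continuous n (q : {poly {mpoly K[n]}}) a e : 0 < e ->
  exists2 d, 0 < d & forall x, near d a x -> forall i, `|(q`_i).@[x] - (q`_i).@[a]| < e.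
Proof.
move=> e0.
have [d d0 Hd] : exists2 d, 0 < d & forall x, near d a x ->
    forall i, (i < size q)%N -> `|(q`_i).@[x] - (q`_i).@[a]| < e.
  elim: (size q) => [|k [d1 d10 H1]]; first by exists 1.
  have [d2 d20 H2] := meval_continuous q`_k a e0.
  have [d [d0 dd1 dd2]] := min_pos d10 d20; exists d => // x Hx i.
  rewrite ltnS leq_eqVlt => /orP[/eqP->|ik]; first by apply: H2; apply: near_le Hx.
  by apply: H1 => //; apply: near_le Hx.
exists d => // x Hx i; have [/Hd|ige] := ltnP i (size q); first exact.
by rewrite nth_default // !meval0 subrr normr0.
Qed.

Lemma norm_prod_ge (r : seq K) (t e : K) : 0 <= e -> (forall s, s \in r -> e <= `|t - s|) ->
  e ^+ size r <= `|(\prod_(s <- r) ('X - s%:P)).[t]|.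
Proof.
move=> e0; elim: r => [|s r IHr] H; first by rewrite big_nil hornerC normr1.
rewrite big_cons hornerM normrM exprS !hornerE ler_pM // ?exprn_ge0 //.
  by apply: H; rewrite mem_head.
by apply: IHr => s' s'r; apply: H; rewrite inE s'r orbT.
Qed.

(** If all roots were at distance at least [e] from [t], the product of linear factors would have
    norm at least [e ^+ (size f).-1] at [t]. *)
Lemma root_near (f : {poly K}) (t e : K) : f \is monic -> 0 < e ->
  `|f.[t]| < e ^+ (size f).-1 -> exists2 s, root f s & `|s - t| < e.
Proof.
move=> mf e0 ft; have [r Er] := closed_field_poly_normal f.
rewrite (monicP mf) scale1r in Er.
have sf : (size f).-1 = size r by rewrite Er size_prod_XsubC.
apply: contrapT => nex; suff : e ^+ (size f).-1 <= `|f.[t]| by move/(lt_le_trans ft); rewrite ltxx.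
rewrite sf [in X in _ <= X]Er; apply: norm_prod_ge => [|s sr]; first exact: ltW.
rewrite distrC real_leNgt ?ger0_real ?normr_ge0 ?(ltW e0) //; apply/negP => lt.
by apply: nex; exists s => //; rewrite Er root_prod_XsubC.
Qed.

(** For [|t| > 1], the leading term is isolated and the equation divided by the next lower power of
    [|t|]. *)
Lemma root_bound (f : {poly K}) (B t : K) : f \is monic ->
  (forall i, `|f`_i| <= B) -> root f t -> `|t| <= 1 + (size f)%:R * B.
Proof.
move=> mf HB rt; have B0 : 0 <= B := le_trans (normr_ge0 _) (HB 0).
have f0 : f != 0 by apply: monic_neq0.
have [t1|t1] := real_ltP (real1 K) (normr_real t); last first.
  by apply: le_trans t1 _; rewrite lerDl mulr_ge0.
have [k sf] : exists k, size f = k.+1 by exists (size f).-1; rewrite prednK ?size_poly_gt0.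
have fk : f`_k = 1 by have := monicP mf; rewrite lead_coefE sf.
have : f.[t] = 0 by apply/rootP.
rewrite horner_coef sf big_ord_recr /= fk mul1r => /eqP; rewrite addr_eq0 eq_sym eqr_oppLR => /eqP tk.
case: k => [|k] in sf fk tk *.
  by move: tk; rewrite big_ord0 oppr0 expr0 => /eqP; rewrite oner_eq0.
have tk0 : 0 < `|t| ^+ k by rewrite exprn_gt0 // (lt_trans ltr01).
rewrite -(ler_pM2r tk0) -exprS -normrX tk normrN.
apply: le_trans (ler_norm_sum _ _ _) _.
apply: (@le_trans _ _ (\sum_(i < k.+1) B * `|t| ^+ k)).
  apply: ler_sum => i _; rewrite normrM normrX ler_pM ?exprn_ge0 //.
  by rewrite ler_weXn2l ?ltW // -ltnS.
rewrite sumr_const card_ord -mulrnAl; apply: ler_wpM2r; first exact: ltW.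
by rewrite mulr_natl [X in _ <= 1 + X]mulrS addrA lerDr addr_ge0.
Qed.

Lemma avoid_small (s : seq K) d : 0 < d -> exists2 x, 0 < x < d & x \notin s.
Proof.
move=> d0; apply: contrapT => nex.
pose u := [seq d / k.+2%:R | k <- iota 0 (size s).+1].
have us : {subset u <= s}.
  move=> _ /mapP[k _ ->]; apply: contrapT => /negP nin; apply: nex; exists (d / k.+2%:R) => //.
  by rewrite divr_gt0 //= ltr_pdivrMr // ltr_pMr // ltr1n.
have uu : uniq u.
  rewrite map_inj_uniq ?iota_uniq // => k l /(mulfI (lt0r_neq0 d0))/invr_inj/eqP.
  by rewrite eqr_nat => /eqP[].
by have := uniq_leq_size uu us; rewrite size_map size_iota ltnn.
Qed.

Lemma poly_roots (f : {poly K}) : f != 0 -> {r : seq K | forall x, root f x = (x \in r)}.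
Proof.
move=> f0; have [r Er] := closed_field_poly_normal f; exists r => x.
by rewrite Er rootZ ?lead_coef_eq0 // root_prod_XsubC.
Qed.

Lemma mpoly_on_line n (h : {mpoly K[n]}) (a b : 'I_n -> K) :
  exists f : {poly K}, forall s, f.[s] = h.@[fun i => a i + b i * s].
Proof.
pose l i : {poly K} := (a i)%:P + b i *: 'X.
exists (mmap polyC l h) => s.
apply: (mpoly_rmorph_eq (f := horner_eval s \o mmap polyC l) (g := meval _)) => [u|i] /=.
  by rewrite mmapC mevalC /horner_eval hornerC.
by rewrite mmapX mmap1U mevalXU /horner_eval /l !hornerE.
Qed.

Lemma mpoly_neq0_point n (h : {mpoly K[n]}) : h != 0 -> exists x, h.@[x] != 0.
Proof.
move=> h0; have pp : is_prime (fun q : {mpoly K[n]} => q = 0).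
  split; [split| |] => [|a b -> ->|a b ->||a b] //; rewrite ?addr0 ?mulr0 //.
    by apply/eqP/oner_neq0.
  by move/eqP; rewrite mulf_eq0 => /orP[]/eqP; [left|right].
have [a na Ha] := prime_specialize pp (elimN eqP h0).
have [||c [_ hc]] := Ha K idfun.
- by move=> b /eqP; rewrite mpolyC_eq0 => /eqP.
- by apply/eqP => /= a0; apply: na; rewrite a0 mpolyC0.
by exists c.
Qed.

Lemma mpoly_eq_values n (p q : {mpoly K[n]}) : (forall x, p.@[x] = q.@[x]) -> p = q.
Proof.
move=> H; apply/eqP; rewrite -subr_eq0; apply/negPn/negP => /mpoly_neq0_point[x].
by rewrite mevalB H subrr eqxx.
Qed.

Lemma poly_mpoly_eq_values n (p q : {poly {mpoly K[n]}}) :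
  (forall t s, (map_poly (meval t) p).[s] = (map_poly (meval t) q).[s]) -> p = q.
Proof.
move=> H; apply/polyP => i; apply: mpoly_eq_values => t.
have : map_poly (meval t) p = map_poly (meval t) q.
  apply/eqP; rewrite -subr_eq0; set f := (X in X == 0); apply/negPn/negP => f0.
  have [r Er] := poly_roots f0; have [x _] := avoid_small r ltr01.
  by rewrite -Er /root !hornerE H subrr eqxx.
by move/polyP/(_ i); rewrite !coef_map.
Qed.

(* Restrict [h] to the line joining [a] to a point where [h] does not vanish. *)
Lemma near_neq0 n (h : {mpoly K[n]}) a e : h != 0 -> 0 < e ->
  exists2 x, near e a x & h.@[x] != 0.
Proof.
move=> /mpoly_neq0_point[c hc] e0.
have [f fE] := mpoly_on_line h a (fun i => c i - a i).
have f0 : f != 0.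
  apply/eqP => f0; move: hc; rewrite -(meval_eq (v1 := fun i => a i + (c i - a i) * 1)).
    by rewrite -fE f0 horner0 eqxx.
  by move=> i; rewrite mulr1 addrC subrK.
have [r Er] := poly_roots f0.
pose B := 1 + \sum_i `|c i - a i|.
have B0 : 0 < B by rewrite ltr_pwDl // sumr_ge0.
have [s /andP[s0 se] sr] := avoid_small r (divr_gt0 e0 B0).
exists (fun i => a i + (c i - a i) * s) => [i|].
  rewrite addrC addKr normrM (gtr0_norm s0); apply: le_lt_trans (_ : B * s < e).
    apply: ler_wpM2r; first exact: ltW.
    rewrite /B (bigD1 i) //= addrCA lerDl addr_ge0 //.
    exact: sumr_ge0.
  by rewrite mulrC -ltr_pdivlMr.
by rewrite -fE; apply: contra sr; rewrite -Er.
Qed.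

End EuclideanTopology.

(** * Linear projections *)

Section Shear.
Variables (K : numClosedFieldType) (n : nat).
Implicit Types (w t : 'I_n -> K) (P : {mpoly K[n.+1]}) (q : {poly {mpoly K[n]}}).

(** Coordinates adapted to the direction [(w, 1)]: [t] is where the line in this direction meets the
    hyperplane on which the last coordinate is zero, and [s] is the last coordinate. [shear w]
    rewrites a polynomial in them, as a polynomial in [s] over those in [t]. *)
Definition shear_pt w t s : 'I_n.+1 -> K := rcons_pt (fun i => t i + w i * s) s.

Definition shear_proj w (x : 'I_n.+1 -> K) : 'I_n -> K :=
  fun i => widen_pt x i - w i * x ord_max.

Lemma shear_proj_pt w t s : shear_proj w (shear_pt w t s) = t.
Proof. by apply/funext => i; rewrite /shear_proj /shear_pt widen_rcons_pt rcons_pt_max addrK. Qed.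

Lemma shear_pt_proj w x : shear_pt w (shear_proj w x) (x ord_max) = x.
Proof.
rewrite -[RHS]rcons_pt_eta /shear_pt; congr rcons_pt.
by apply/funext => i; rewrite /shear_proj subrK.
Qed.

Definition polyCC (c : K) : {poly {mpoly K[n]}} := c%:MP%:P.
HB.instance Definition _ := GRing.RMorphism.copy polyCC (polyC \o @mpolyC n K).

Definition shear_var w : 'I_n.+1 -> {poly {mpoly K[n]}} :=
  rcons_pt (fun i => ('X_i)%:P + (w i)%:MP *: 'X) 'X.

Definition shear w : {mpoly K[n.+1]} -> {poly {mpoly K[n]}} := mmap polyCC (shear_var w).
HB.instance Definition _ w := GRing.RMorphism.on (shear w).

Lemma shearE w P t s : (map_poly (meval t) (shear w P)).[s] = P.@[shear_pt w t s].
Proof.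
apply: (mpoly_rmorph_eq (f := horner_eval s \o map_poly (meval t) \o shear w)
  (g := meval _)) => [c|i] /=.
  by rewrite /shear mmapC /polyCC map_polyC /= mevalC /horner_eval hornerC mevalC.
rewrite /shear mmapX mmap1U mevalXU /shear_var /shear_pt /rcons_pt /horner_eval.
case: unlift => [j|]; last by rewrite map_polyX hornerX.
rewrite -mul_polyC !(rmorphD, rmorphM) /= !map_polyC map_polyX /= !hornerE.
by rewrite mevalXU mevalC.
Qed.

Definition unshear w : {poly {mpoly K[n]}} -> {mpoly K[n.+1]} :=
  (mmap (@mpolyC n.+1 K) (rcons_pt
    (fun i => 'X_(widen_ord (leqnSn n) i) - (w i)%:MP * 'X_ord_max) 'X_ord_max)
    \o @mpoly_of_poly n K).

HB.instance Definition _ w := GRing.RMorphism.on (unshear w).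

Lemma unshearE w q x : (unshear w q).@[x] = (map_poly (meval (shear_proj w x)) q).[x ord_max].
Proof.
rewrite /unshear /=; set h := rcons_pt _ _.
have -> : (mmap (@mpolyC n.+1 K) h (mpoly_of_poly q)).@[x] =
    mmap idfun (fun i => (h i).@[x]) (mpoly_of_poly q) by exact: (mmap_comp idfun idfun).
rewrite mmap_mpoly_of_poly /h rcons_pt_max mevalXU; congr ((map_poly (meval _) q).[_]).
apply/funext => i; rewrite /widen_pt -/(widen_pt (rcons_pt _ _) i).
by rewrite widen_rcons_pt mevalB mevalM !mevalXU mevalC.
Qed.

Lemma unshearK w P : unshear w (shear w P) = P.
Proof. by apply: mpoly_eq_values => x; rewrite unshearE shearE shear_pt_proj. Qed.

(** Since [c] may be zero, this is multiplicative without any discussion of degrees. *)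
Definition top_coef d q c := (size q <= d.+1)%N /\ q`_d = c%:MP.

Lemma top_coefM d1 d2 q1 q2 c1 c2 :
  top_coef d1 q1 c1 -> top_coef d2 q2 c2 -> top_coef (d1 + d2) (q1 * q2) (c1 * c2).
Proof.
move=> [s1 E1] [s2 E2]; split.
  apply: leq_trans (size_polyMleq _ _) _.
  by rewrite -subn1 leq_subLR add1n -addnS -addSn leq_add.
rewrite coefM (bigD1 (inord d1)) //= inordK ?ltnS ?leq_addr // addKn E1 E2 mpolyCM.
rewrite big1 ?addr0 // => i; rewrite -val_eqE /= inordK ?ltnS ?leq_addr // => id1.
have [lt|ge] := ltnP d1 i; first by rewrite nth_default ?mul0r // (leq_trans s1).
rewrite [X in _ * X]nth_default ?mulr0 // (leq_trans s2) //.
have {}id1 : (i < d1)%N by rewrite ltn_neqAle id1.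
by rewrite ltn_subRL ltn_add2r.
Qed.

Lemma top_coefX d q c k : top_coef d q c -> top_coef (d * k) (q ^+ k) (c ^+ k).
Proof.
move=> H; elim: k => [|k IHk].
  by rewrite muln0 !expr0; split; rewrite ?size_poly1 // coef1 mpolyC1.
by rewrite mulnS !exprS; apply: top_coefM.
Qed.

Lemma top_coef_prod (I : Type) (r : seq I) (d : I -> nat) (q : I -> {poly {mpoly K[n]}}) (c : I -> K) :
  (forall i, top_coef (d i) (q i) (c i)) ->
  top_coef (\sum_(i <- r) d i) (\prod_(i <- r) q i) (\prod_(i <- r) c i).
Proof.
move=> H; elim: r => [|i r IHr].
  by rewrite !big_nil; split; rewrite ?size_poly1 // coef1 mpolyC1.
by rewrite !big_cons; apply: top_coefM.
Qed.

Definition mnm_widen_pt (m : 'X_{1..n.+1}) : 'X_{1..n} := [multinom widen_pt m i | i < n].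

(** Each variable becomes [t_i + w_i s], or [s] for the last one, so the coefficient of the top
    power of [s] is a monomial in [w] alone. *)
Lemma shear_mnm w (m : 'X_{1..n.+1}) :
  top_coef (mdeg m) (shear w 'X_[m]) ('X_[mnm_widen_pt m] : {mpoly K[n]}).@[w].
Proof.
rewrite /shear mmapX /mmap1 mevalX mdegE.
have -> : \prod_i w i ^+ mnm_widen_pt m i = \prod_i rcons_pt w 1 i ^+ m i.
  rewrite big_ord_recr /= rcons_pt_max expr1n mulr1; apply: eq_bigr => i _.
  by rewrite -[rcons_pt _ _ _]/(widen_pt (rcons_pt w 1) i) widen_rcons_pt mnmE.
have H i : top_coef 1 (shear_var w i) (rcons_pt w 1 i).
  rewrite /shear_var /rcons_pt; case: unlift => [j|]; split.
  - apply: leq_trans (size_polyD _ _) _; rewrite geq_max.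
    rewrite (leq_trans (size_polyC_leq1 _)) // (leq_trans (size_scale_leq _ _)) //.
    by rewrite size_polyX.
  - by rewrite coefD coefC coefZ coefX mulr1 add0r.
  - by rewrite size_polyX.
  - by rewrite coefX mpolyC1.
have := @top_coef_prod _ (index_enum 'I_n.+1) _ _ _ (fun i => top_coefX (m i) (H i)).
by congr top_coef; apply: eq_bigr => i _; rewrite mul1n.
Qed.

(* [L] is the homogeneous part of [P] of top degree, with the last variable set to [1]. *)
Lemma shear_top P : P != 0 -> exists d (L : {mpoly K[n]}), L != 0 /\
  forall w, top_coef d (shear w P) L.@[w].
Proof.
move=> P0; pose d := (msize P).-1.
pose top := [seq m <- msupp P | mdeg m == d].
pose L := \sum_(m <- top) P@_m *: 'X_[mnm_widen_pt m] : {mpoly K[n]}.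
have sP m : m \in msupp P -> (mdeg m <= d)%N.
  by move=> /msize_mdeg_lt; rewrite /d; case: (msize P).
(* Among monomials of one degree, setting the last variable to [1] is injective, so nothing cancels
   in [L]. *)
have inj m m' : mdeg m = d -> mdeg m' = d -> mnm_widen_pt m = mnm_widen_pt m' -> m = m'.
  move=> md m'd E; have Ei i : widen_pt m i = widen_pt m' i.
    by have /mnmP/(_ i) := E; rewrite !mnmE.
  have Em : m ord_max = m' ord_max.
    apply/eqP; rewrite -(eqn_add2l (\sum_i widen_pt m i)) {2}(eq_bigr _ (fun i _ => Ei i)).
    by move: md m'd; rewrite !mdegE !big_ord_recr /= => -> ->.
  by apply/mnmP => i; rewrite -[m in LHS]/(m) -(rcons_pt_eta m) -(rcons_pt_eta m') Em;
    congr (rcons_pt _ _ _); apply/funext.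
exists d, L; split.
  have [m0 m0P m0d] : exists2 m, m \in msupp P & mdeg m = d.
    exists (mlead P); first exact: mlead_supp.
    by rewrite /d -mlead_deg.
  apply/eqP => /mpolyP/(_ (mnm_widen_pt m0)).
  rewrite mcoeff0 raddf_sum (bigD1_seq m0) ?filter_uniq ?msupp_uniq //=; last first.
    by rewrite mem_filter m0d eqxx.
  rewrite mcoeffZ mcoeffX eqxx mulr1 big_seq_cond big1 ?addr0 => [|m].
    by apply/eqP; rewrite -mcoeff_msupp.
  rewrite mem_filter => /andP[/andP[/eqP md _] mm0].
  rewrite mcoeffZ mcoeffX; case: eqP => [/(inj _ _ md m0d)/eqP|]; last by rewrite mulr0.
  by rewrite (negPf mm0).
move=> w; have -> : shear w P = \sum_(m <- msupp P) (P@_m)%:MP *: shear w 'X_[m].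
  rewrite {1}[P]mpolyE rmorph_sum; apply: eq_bigr => m _.
  rewrite -mul_mpolyC [LHS]rmorphM /= -mul_polyC; congr (_ * _).
  exact: mmapC.
split.
  rewrite big_seq; apply: (big_ind (fun q : {poly {mpoly K[n]}} => size q <= d.+1)%N).
  - by rewrite size_poly0.
  - by move=> p q Hp Hq; rewrite (leq_trans (size_polyD _ _)) // geq_max Hp.
  - move=> m mP; apply: leq_trans (size_scale_leq _ _) _.
    by have [s _] := shear_mnm w m; rewrite (leq_trans s) // ltnS sP.
rewrite coef_sum /L big_filter (raddf_sum (meval w)) (raddf_sum (@mpolyC n K)) [RHS]big_mkcond big_seq [RHS]big_seq.
apply: eq_bigr => m mP; rewrite coefZ; have [s E] := shear_mnm w m.
case: eqP => [md|/eqP md]; first by rewrite /= mevalZ mpolyCM -md E.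
rewrite nth_default ?mulr0 // (leq_trans s) // ltn_neqAle md; exact: sP.
Qed.

End Shear.

(* Unification is intractable when it unfolds these two. *)
#[global] Opaque shear unshear.

(** * Gauss's lemma *)

Section Gauss.
Variable K : numClosedFieldType.

Lemma poly2_factor (P : {poly {poly K}}) (x : K) : map_poly (horner_eval x) P = 0 ->
  exists Q, P = ('X - x%:P)%:P * Q.
Proof.
move=> P0; exists (\poly_(i < size P) (P`_i %/ ('X - x%:P))).
apply/polyP => i; rewrite coefCM coef_poly; case: ltnP => ip.
  rewrite mulrC divpK // dvdp_XsubCl; apply/rootP.
  by have /polyP/(_ i) := P0; rewrite coef_map coef0.
by rewrite nth_default // mulr0.
Qed.

(** Induction on the degree of [c]: a linear factor of [c] divides [P] or [G] and is cancelled. Once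
    [c] is constant, the leading coefficient of [P] divides it and is a unit. *)
Lemma gauss_univariate (P G M : {poly {poly K}}) (c : {poly K}) : M \is monic -> c != 0 ->
  P * G = c%:P * M -> forall i, lead_coef P %| P`_i.
Proof.
move=> mM; have [k] := ubnP (size c); elim: k => // k IHk in c P G * => sc c0 E i.
have [sc1|sc1] := eqVneq (size c) 1.
  have /(congr1 (@lead_coef _)) := E.
  rewrite !lead_coefM lead_coefC (monicP mM) mulr1 => El.
  have lc : lead_coef P %| c by rewrite -El dvdp_mulIl.
  apply: dvdp_trans lc _; case/eqP/size_poly1P: sc1 => a a0 ->.
  by rewrite -alg_polyC dvdpZl ?dvd1p.
have /closed_rootP[x /factor_theorem[c' Ec]] := sc1.
have c'0 : c' != 0 by apply: contraNneq c0 => c'0; rewrite Ec c'0 mul0r.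
have sc' : (size c' < k)%N.
  move: sc; rewrite Ec size_Mmonic ?monicXsubC // size_XsubC addn2 /=.
  by rewrite ltnS.
have X0 : ('X - x%:P)%:P != 0 :> {poly {poly K}} by rewrite polyC_eq0 polyXsubC_eq0.
have : map_poly (horner_eval x) P * map_poly (horner_eval x) G = 0.
  by rewrite -rmorphM /= E rmorphM /= map_polyC /= /horner_eval Ec !hornerE subrr mulr0 mul0r.
move/eqP; rewrite mulf_eq0 => /orP[]/eqP/poly2_factor[Q EQ].
  have /(IHk _ _ _ sc' c'0)/(_ i) : Q * G = c'%:P * M.
    apply: (mulfI X0); rewrite !mulrA -EQ E Ec polyCM.
    by rewrite (mulrC _ (_ - _)%:P).
  by rewrite EQ lead_coefM lead_coefC coefCM dvdp_mul2l // polyXsubC_eq0.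
apply: (IHk c' P Q sc' c'0 _ i).
by apply: (mulfI X0); rewrite mulrCA -EQ E Ec polyCM mulrA (mulrC _ (_ - _)%:P).
Qed.

Lemma gauss_specialize (B : comNzRingType) (phi : {rmorphism B -> {poly K}})
    (P G M : {poly B}) (c : B) :
  M \is monic -> P * G = c%:P * M -> phi c != 0 -> phi (lead_coef P) != 0 ->
  forall i, phi (lead_coef P) %| phi P`_i.
Proof.
move=> mM E phic phiP i.
have mM' : map_poly phi M \is monic by apply: monic_map.
have E' : map_poly phi P * map_poly phi G = (phi c)%:P * map_poly phi M.
  by rewrite -map_polyC -!rmorphM /= E.
have := gauss_univariate mM' phic E' i.
by rewrite lead_coef_map_eq // coef_map.
Qed.

(** Reduction to one variable by restricting to parallel lines. Their direction is chosen so that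
    the leading coefficient [b] of [P] is monic along them up to a constant, which permits Euclidean
    division of [P_i] by [b]; the remainder is shown to vanish. *)
Lemma gauss_mpoly n (P G M : {poly {mpoly K[n]}}) (c : {mpoly K[n]}) : M \is monic -> c != 0 ->
  P * G = c%:P * M -> forall i, exists u, P`_i = lead_coef P * u.
Proof.
move=> mM c0 E i.
have P0 : P != 0.
  apply/eqP => P0; move: E; rewrite P0 mul0r => /esym/eqP.
  by rewrite mulf_eq0 polyC_eq0 (negPf c0) (negPf (monic_neq0 mM)).
have b0 : lead_coef P != 0 by rewrite lead_coef_eq0.
case: n P G M c mM c0 E P0 b0 => [|n] P G M c mM c0 E P0; set b := lead_coef P => b0.
  have Eb : b = (b@_0%MM)%:MP.
    apply/mpolyP => m; rewrite mcoeffC.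
    by have -> : m = 0%MM; [apply/mnmP; case|rewrite eqxx mulr1].
  exists ((b@_0%MM)^-1%:MP * P`_i); rewrite mulrA {1}Eb -mpolyCM mulfV ?mul1r //.
  by apply: contraNneq b0 => b00; rewrite Eb b00 mpolyC0.
have [d [L [/mpoly_neq0_point[w Lw] top]]] := shear_top b0.
have [sb bd] := top w; pose sh := shear w; set u := P`_i.
have ssb : size (sh b) = d.+1.
  apply/eqP; rewrite eqn_leq sb ltnNge; apply/negP => /leq_sizeP/(_ d (leqnn _)).
  by rewrite bd => /eqP; rewrite mpolyC_eq0 (negPf Lw).
have lb : lead_coef (sh b) = L.@[w]%:MP by rewrite lead_coefE ssb.
have lbu : lead_coef (sh b) \is a GRing.unit.
  by rewrite lb; apply: (rmorph_unit (@mpolyC n K)); rewrite unitfE.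
have Eu := Pdiv.IdomainUnit.divp_eq lbu (sh u).
set Q := sh u %/ sh b in Eu; set R := sh u %% sh b in Eu.
have sb0 : sh b != 0 by rewrite -size_poly_eq0 ssb.
have sR : (size R < d.+1)%N by rewrite -ssb ltn_modp.
have c'0 : sh c != 0.
  by apply: contraNneq c0 => c'0; rewrite -(unshearK w c) -/(sh c) c'0 rmorph0.
have R0 : R = 0.
  apply/polyP => j; rewrite coef0; apply/eqP; apply: contraNT c'0 => Rj; apply/eqP.
  (* Divisibility is available only for those [t] where the leading coefficient of [sh c] is
     nonzero; multiplying by it gives an identity valid at every [t]. *)
  suff: lead_coef (sh c) * R`_j = 0.
    by move/eqP; rewrite mulf_eq0 (negPf Rj) orbF lead_coef_eq0 => /eqP.
  apply: mpoly_eq_values => t; rewrite mevalM meval0; apply/eqP; rewrite mulf_eq0.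
  case: eqVneq => //= lct; apply/eqP.
  have [phi phiE] : exists phi : {rmorphism {mpoly K[n.+1]} -> {poly K}},
      forall q, phi q = map_poly (meval t) (sh q) by exists (map_poly (meval t) \o sh).
  have phic : phi c != 0.
    rewrite phiE; apply: contraNneq lct => /polyP/(_ (size (sh c)).-1).
    by rewrite coef_map coef0 lead_coefE => ->.
  have ltb : meval t (lead_coef (sh b)) != 0 by rewrite lb mevalC.
  have sphib : size (phi b) = d.+1 by rewrite phiE -ssb; apply: size_map_poly_id0 ltb.
  have phib : phi b != 0 by rewrite -size_poly_eq0 sphib.
  have bu : phi b %| phi u := gauss_specialize mM E phic phib i.
  have ER : map_poly (meval t) R = 0.
    have := congr1 (map_poly (meval t)) Eu.
    rewrite rmorphD rmorphM /= => EuT.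
    have : phi b %| map_poly (meval t) R.
      have -> : map_poly (meval t) R = phi u - map_poly (meval t) Q * phi b.
        apply/eqP; rewrite eq_sym subr_eq addrC; apply/eqP.
        by rewrite (phiE u) (phiE b); exact: EuT.
      by rewrite dvdp_sub // dvdp_mull.
    move=> dvd; apply/eqP; apply: contraT => nz.
    have := dvdp_leq nz dvd; rewrite sphib leqNgt => /negP[].
    by apply: leq_ltn_trans sR; apply: size_poly.
  by have /polyP/(_ j) := ER; rewrite coef_map coef0.
exists (unshear w Q).
rewrite -[LHS](unshearK w) -/(sh _) -/u Eu R0 addr0 mulrC.
apply: mpoly_eq_values => x; rewrite mevalM !unshearE rmorphM hornerM.
by rewrite -(unshearE w (sh b)) /sh unshearK.
Qed.

End Gauss.

(** * Euclidean density of constructible sets *)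

Section Density.
Variable K : numClosedFieldType.

Definition zariski_closure n (U : ('I_n -> K) -> Prop) : ('I_n -> K) -> Prop :=
  fun a => forall q : {mpoly K[n]}, (forall x, U x -> q.@[x] = 0) -> q.@[a] = 0.

Definition euclid_dense n := forall (U : ('I_n -> K) -> Prop) a e, constructible U ->
  zariski_closure U a -> 0 < e -> exists2 x, U x & near e a x.

Lemma shear_near n (w : 'I_n -> K) a e : 0 < e -> exists2 d, 0 < d & forall t s,
  near d (shear_proj w a) t -> `|s - a ord_max| < d -> near e a (shear_pt w t s).
Proof.
move=> e0; pose B := 2 + \sum_i `|w i|.
have sw0 : 0 <= \sum_i `|w i| by apply: sumr_ge0.
have B0 : 0 < B by rewrite ltr_wpDr.
exists (e / B) => [|t s Ht Hs i]; first exact: divr_gt0.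
rewrite /shear_pt -[a](rcons_pt_eta) /rcons_pt; case: unliftP => [j _|_]; last first.
  apply: lt_le_trans Hs _; rewrite ler_pdivrMr // ler_pMr // /B.
  by apply: (@le_trans _ _ 2); rewrite ?ler1n // lerDl.
have -> : t j + w j * s - widen_pt a j = (t j - shear_proj w a j) + w j * (s - a ord_max).
  by rewrite /shear_proj; ring.
apply: le_lt_trans (ler_normD _ _) _; rewrite normrM.
have eE : e = e / B + (1 + \sum_i `|w i|) * (e / B).
  have : e = B * (e / B) by rewrite mulrC divfK ?lt0r_neq0.
  by move: (e / B) => u ->; rewrite /B; ring.
rewrite [ltRHS]eE; apply: ltrD; first exact: Ht.
have wj : `|w j| <= \sum_i `|w i| by rewrite (bigD1 j) //= lerDl sumr_ge0.
apply: (@le_lt_trans _ _ ((\sum_i `|w i|) * `|s - a ord_max|)).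
  exact: ler_wpM2r.
apply: (@le_lt_trans _ _ ((\sum_i `|w i|) * (e / B))).
  by apply: ler_wpM2l => //; apply: ltW.
by rewrite ltr_pM2r ?divr_gt0 // ltrDr.
Qed.

Lemma constr_shear n (w : 'I_n -> K) (U : ('I_n.+1 -> K) -> Prop) :
  constructible U -> constructible (fun t => exists s, U (shear_pt w t s)).
Proof.
move=> cU; pose F : 'I_n.+1 -> {mpoly K[n.+1]} := rcons_pt
  (fun i => 'X_(widen_ord (leqnSn n) i) + (w i)%:MP * 'X_ord_max) 'X_ord_max.
apply: constr_iff (constr_exists1 (constr_pull F cU)) => t.
suff FE s : (fun i => (F i).@[rcons_pt t s]) = shear_pt w t s.
  by split=> -[s Us]; exists s; move: Us; rewrite FE.
have zw := widen_rcons_pt t s; have zm := rcons_pt_max t s.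
move: (rcons_pt t s) zw zm => z <- <-.
apply/funext => i; rewrite /F /shear_pt /rcons_pt; case: unlift => [j|].
  by rewrite mevalD mevalM mevalC !mevalXU.
by rewrite mevalXU.
Qed.

(** The restrictions of [I] to the line over [b] form an ideal of [{poly K}], and [Q] lifts a
    generator of it; quotients are lifted with constant coefficients. *)
Lemma residue_generator n (b : 'I_n -> K) (I : {poly {mpoly K[n]}} -> Prop) M :
  is_ideal I -> I M -> map_poly (meval b) M != 0 ->
  exists Q, [/\ I Q, map_poly (meval b) Q != 0 &
    forall q, I q -> map_poly (meval b) Q %| map_poly (meval b) q].
Proof.
move=> Ii IM M0; pose res (q : {poly {mpoly K[n]}}) : {poly K} := map_poly (meval b) q.
have [Q [IQ Q0] Qmin] := @exists_argmin _ (fun q => I q /\ res q != 0) (fun q => size (res q))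
  (ex_intro _ M (conj IM M0)).
exists Q; split=> // q Iq; rewrite -!/(res _) /dvdp; apply: contraT => nz.
pose lift (f : {poly K}) : {poly {mpoly K[n]}} := map_poly (@mpolyC n K) f.
have liftK f : res (lift f) = f.
  by apply/polyP => i; rewrite !coef_map /= mevalC.
have Ir : I (q - lift (res q %/ res Q) * Q) by apply: idealB => //; apply: idealM.
have resr : res (q - lift (res q %/ res Q) * Q) = res q %% res Q.
  by rewrite /res rmorphB rmorphM /= -!/(res _) liftK {1}(divp_eq (res q) (res Q)) addrC addKr.
have := Qmin _ (conj Ir _); rewrite resr => /(_ nz).
by rewrite leqNgt ltn_modpN0.
Qed.

(* [M] bounds the fibres of the projection along [w]; since the line through [a] meets the
   Zariski closure of [U] only at [a], some [Q] vanishing on [U] restricts to [c (X - a_n)^m]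
   on it, which forces the fibre over a point close to the projection of [a] to be close to [a]. *)
Lemma dense_fibre n (w : 'I_n -> K) (U : ('I_n.+1 -> K) -> Prop) a e (M : {poly {mpoly K[n]}}) :
  euclid_dense n -> constructible U -> zariski_closure U a -> 0 < e ->
  M \is monic -> (forall x, U x -> (unshear w M).@[x] = 0) ->
  (forall s, zariski_closure U (shear_pt w (shear_proj w a) s) -> s = a ord_max) ->
  exists2 x, U x & near e a x.
Proof.
move=> IH cU aU e0 mM MU line; set b := shear_proj w a; set s0 := a ord_max in line *.
have Ush x : U x -> U (shear_pt w (shear_proj w x) (x ord_max)) by rewrite shear_pt_proj.
have bU : zariski_closure (fun t => exists s, U (shear_pt w t s)) b.
  move=> q Hq; have := aU (unshear w q%:P).
  rewrite unshearE map_polyC hornerC; apply=> x /Ush Ux.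
  by rewrite unshearE map_polyC hornerC /=; apply: Hq; exists (x ord_max).
pose I q := forall x, U x -> (unshear w q).@[x] = 0.
pose res (q : {poly {mpoly K[n]}}) : {poly K} := map_poly (meval b) q.
have Iideal : is_ideal I.
  exact: (@preim_ideal {poly {mpoly K[n]}} {mpoly K[n.+1]} (unshear w) _ (vanishing_ideal U)).
have [Q [IQ Q0 Qdvd]] := residue_generator Iideal MU (monic_neq0 (monic_map (meval b) mM)).
have [r Er] := closed_field_poly_normal (res Q).
(* A root of the generator is a common zero of all restrictions, that is, a point of the Zariski
   closure of [U] on the line. *)
have rs0 s : s \in r -> s = s0.
  move=> sr; apply: line => q Hq.
  have Iq : I (shear w q) by move=> x Ux; rewrite unshearK; apply: Hq.
  have /dvdpP[u Eu] := Qdvd _ Iq; rewrite -shearE Eu hornerM.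
  have /rootP-> : root (res Q) s by rewrite Er rootZ ?lead_coef_eq0 // root_prod_XsubC.
  by rewrite mulr0.
set c := lead_coef (res Q) in Er; have c0 : c != 0 by rewrite lead_coef_eq0.
have resQ s : `|(res Q).[s]| = `|c| * `|s - s0| ^+ size r.
  rewrite Er hornerZ normrM; congr (_ * _); rewrite horner_prod normr_prod.
  rewrite big_seq (eq_bigr (fun=> `|s - s0|)) => [|s' /rs0->]; last by rewrite !hornerE.
  by rewrite -big_seq big_const_seq count_predT iter_mulr_1.
have [d1 d10 H1] := shear_near w a e0.
have [d2 d20 HM] := coefs_continuous M b ltr01.
pose BM := 1 + \sum_(i < size M) `|(M`_i).@[b]|.
have BMi i : `|(M`_i).@[b]| + 1 <= BM.
  rewrite addrC lerD2l; have [ilt|ige] := ltnP i (size M).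
    by rewrite (bigD1 (Ordinal ilt)) //= lerDl sumr_ge0.
  by rewrite nth_default // meval0 normr0 sumr_ge0.
pose B := 1 + (size M)%:R * BM.
have BM0 : 0 < BM by rewrite ltr_pwDl // sumr_ge0.
have B0 : 0 < B by rewrite ltr_pwDl // mulr_ge0 // ltW.
pose S := 1 + \sum_(i < size Q) B ^+ i.
have S0 : 0 < S by rewrite ltr_pwDl // sumr_ge0 // => i _; rewrite exprn_ge0 // ltW.
(* On the fibre over a nearby [t], [M] forces [|s| <= B] and [Q] vanishes. If its coefficients move
   by less than this quantity, [res Q] at [s] has norm below [|c| * d1 ^+ size r], whence
   [|s - s0| < d1]. The summand [1] in [S] makes the inequality strict. *)
have eta0 : 0 < `|c| * d1 ^+ size r / S by rewrite divr_gt0 // mulr_gt0 ?normr_gt0 // exprn_gt0.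
have [d3 d30 HQ] := coefs_continuous Q b eta0.
have [d4 [d40 d41 d42]] := min_pos d10 d20.
have [d [d0 dd4 dd3]] := min_pos d40 d30.
have [t [s Us] tb] := IH _ b d (constr_shear w cU) bU d0.
exists (shear_pt w t s) => //; apply: H1.
  exact: near_le (le_trans dd4 d41) tb.
have evI q : I q -> (map_poly (meval t) q).[s] = 0.
  by move=> /(_ _ Us); rewrite unshearE shear_proj_pt /shear_pt rcons_pt_max.
have sB : `|s| <= B.
  have sM : size (map_poly (meval t) M) = size M.
    by rewrite size_map_poly_id0 // (monicP mM) meval1 oner_neq0.
  rewrite /B -sM; apply: (root_bound (monic_map (meval t) mM)) => [i|]; last first.
    by apply/rootP; apply: evI MU.
  rewrite coef_map /=; apply: le_trans (BMi i).
  rewrite -[X in `|X|](subrK (M`_i).@[b]) addrC (le_trans (ler_normD _ _)) // lerD2l.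
  by apply: ltW; apply: HM; apply: near_le (le_trans dd4 d42) tb.
rewrite real_ltNge ?normr_real ?gtr0_real //; apply/negP => ge.
have : `|(res Q).[s]| < `|c| * d1 ^+ size r.
  have hor u : (map_poly (meval u) Q).[s] = \sum_(i < size Q) (Q`_i).@[u] * s ^+ i.
    rewrite (@horner_coef_wide _ (size Q)) ?size_poly //.
    by apply: eq_bigr => i _; rewrite coef_map.
  rewrite -[(res Q).[s]]subr0 -(evI _ IQ) !hor -sumrB.
  apply: le_lt_trans (ler_norm_sum _ _ _) _.
  apply: (@le_lt_trans _ _ (`|c| * d1 ^+ size r / S * \sum_(i < size Q) B ^+ i)).
    rewrite mulr_sumr; apply: ler_sum => i _; rewrite -mulrBl normrM normrX.
    apply: ler_pM => //; first exact: exprn_ge0.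
      by rewrite distrC; apply/ltW/HQ; apply: near_le dd3 tb.
    by apply: lerXn2r; rewrite ?nnegrE // (ltW B0).
  rewrite mulrAC ltr_pdivrMr // ltr_pM2l ?ltrDr //.
  by rewrite mulr_gt0 ?normr_gt0 // exprn_gt0.
rewrite resQ ltr_pM2l ?normr_gt0 // => lt.
have : d1 ^+ size r <= `|s - s0| ^+ size r.
  by apply: lerXn2r; rewrite ?nnegrE // (ltW d10).
by move/(lt_le_trans lt); rewrite ltxx.
Qed.

(* By Gauss's lemma the leading coefficient of a generator of [p] over the fraction field divides
   this generator. *)
Lemma hypersurface_generator n (p : {poly {mpoly K[n]}} -> Prop) M g :
  is_prime p -> (forall b, trace p b -> b = 0) -> M \is monic -> p M -> ~ p g ->
  exists P h v, [/\ P \is monic, p P, forall q, p q -> exists s, q = s * P,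
    h != 0 & p (h%:P - v * g)].
Proof.
move=> pp tr mM pM npg.
have [Ip _ pmul] := pp.
have [It _ _] := trace_prime pp; have tr0 := ideal0 It.
have [|P1 [pP1 nlP1 P1min]] := min_lead Ip tr0 (fun b (tb : trace p b) => tb).
  exists M => // /(_ (size M).-1)/tr; rewrite -lead_coefE (monicP mM).
  by apply/eqP/oner_neq0.
have l0 : lead_coef P1 != 0 by apply/eqP => l0; apply: nlP1; rewrite l0.
have P10 : P1 != 0 by rewrite -lead_coef_eq0.
(* Pseudo-division of [M] by [P1] leaves no remainder, so [P1] divides a multiple of the monic [M]
   by a constant, as [gauss_mpoly] requires. *)
have [u Hu] : exists u : nat -> {mpoly K[n]}, forall i, P1`_i = lead_coef P1 * u i.
  have E := Pdiv.Idomain.divp_eq M P1.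
  have r0 : M %% P1 = 0.
    apply/polyP => i; rewrite coef0; apply: tr; apply: P1min; last by rewrite Pdiv.Idomain.ltn_modp.
    have -> : M %% P1 = lead_coef P1 ^+ Pdiv.Idomain.scalp M P1 *: M - M %/ P1 * P1 by rewrite E addrC addKr.
    by apply: idealB => //; [rewrite -mul_polyC|]; apply: idealM.
  rewrite r0 addr0 -mul_polyC mulrC in E.
  have c0 : lead_coef P1 ^+ Pdiv.Idomain.scalp M P1 != 0 by rewrite expf_neq0.
  have /choice[u Hu] := gauss_mpoly mM c0 (esym (etrans (mulrC _ _) (etrans E (mulrC _ _)))).
  by exists u.
pose P := \poly_(i < size P1) u i.
have EP : P1 = (lead_coef P1)%:P * P.
  apply/polyP => i; rewrite coefCM coef_poly; case: ltnP => ip; first exact: Hu.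
  by rewrite nth_default // mulr0.
have sP : size P = size P1 by rewrite [in RHS]EP mul_polyC size_scale.
have mP : P \is monic.
  apply/monicP; apply: (mulfI l0); rewrite mulr1 [in RHS]EP lead_coefM lead_coefC.
  by [].
have pP : p P.
  by have := pP1; rewrite EP => /pmul[/tr/eqP|//]; rewrite (negPf l0).
have Pmin q : p q -> (size q < size P)%N -> forall i, trace p q`_i.
  by move=> pq; rewrite sP; apply: P1min.
have nlP : ~ trace p (lead_coef P).
  by move/tr; rewrite (monicP mP); apply/eqP/oner_neq0.
have [h [v [nh phv]]] := bezout_prime pp pP nlP Pmin npg.
have Pdvd q : p q -> exists s, q = s * P.
  move=> pq; exists (Pdiv.Ring.rdivp q P); rewrite {1}(Pdiv.RingMonic.rdivp_eq mP q).
  suff -> : Pdiv.Ring.rmodp q P = 0 by rewrite addr0.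
  apply/polyP => i; rewrite coef0; apply: tr; apply: Pmin; last first.
    by rewrite Pdiv.Ring.ltn_rmodp monic_neq0.
  have -> : Pdiv.Ring.rmodp q P = q - Pdiv.Ring.rdivp q P * P.
    by rewrite {2}(Pdiv.RingMonic.rdivp_eq mP q) addrC addKr.
  by apply: idealB => //; apply: idealM.
exists P, h, v; split=> //.
by apply/eqP => h0; apply: nh; rewrite h0.
Qed.

(** For [t] close to the projection of [a], the monic generator of [p] is small at the last
    coordinate of [a], hence has a root nearby. Choosing [t] with [h] nonzero keeps [g] nonzero
    there, since [h = v * g] modulo [p]. *)
Lemma dense_hypersurface n (w : 'I_n -> K) (p : {mpoly K[n.+1]} -> Prop) a e g M :
  is_prime p -> (forall q, p q -> q.@[a] = 0) -> ~ p g -> 0 < e ->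
  (forall b, p (unshear w b%:P) -> b = 0) -> M \is monic -> p (unshear w M) ->
  exists x, [/\ forall q, p q -> q.@[x] = 0, g.@[x] != 0 & near e a x].
Proof.
move=> pp pa npg e0 trace0 mM pM.
have pp' : is_prime (fun q => p (unshear w q)).
  exact: (@preim_prime {poly {mpoly K[n]}} {mpoly K[n.+1]} (unshear w) _ pp).
have npg' : ~ p (unshear w (shear w g)) by rewrite unshearK.
have [P [h [v [mP pP Pdvd h0 phv]]]] := hypersurface_generator pp' trace0 mM pM npg'.
have [d1 d10 H1] := shear_near w a e0.
set b := shear_proj w a in H1; set s0 := a ord_max in H1.
have Pb : (map_poly (meval b) P).[s0] = 0 by rewrite -unshearE; apply: pa.
have d1m : 0 < d1 ^+ (size P).-1 by rewrite exprn_gt0.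
have [d2 d20 H2] := meval_continuous P.[s0%:MP] b d1m.
have horP t : (P.[s0%:MP]).@[t] = (map_poly (meval t) P).[s0].
  by rewrite -horner_map /= mevalC.
have [d [d0 dd1 dd2]] := min_pos d10 d20.
have [t tb ht] := near_neq0 b h0 d0.
have {}H2 := H2 t (near_le dd2 tb); rewrite !horP Pb subr0 in H2.
have sP : size (map_poly (meval t) P) = size P.
  by apply: size_map_poly_id0; rewrite (monicP mP) meval1 oner_neq0.
rewrite -sP in H2; have [s rs ss0] := root_near (monic_map (meval t) mP) d10 H2.
have Vp q : p (unshear w q) -> (map_poly (meval t) q).[s] = 0.
  by case/Pdvd => q' ->; rewrite rmorphM hornerM (rootP rs) mulr0.
exists (shear_pt w t s); split.
- by move=> q pq; rewrite -shearE; apply: Vp; rewrite unshearK.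
- have := Vp _ phv; rewrite rmorphB rmorphM /= map_polyC !hornerE /= shearE.
  by move/eqP; rewrite subr_eq0 => /eqP E; apply: contraNneq ht => g0; rewrite E g0 mulr0.
- apply: H1; [exact: near_le dd1 tb|exact: ss0].
Qed.

Lemma avoid_seq (s : seq K) : exists x, x \notin s.
Proof. by have [x _ xs] := avoid_small s ltr01; exists x. Qed.

(* In the direction [w0 + mu w1], a further zero of [P] and [r] on the line through [a] forces
   [mu] to be a quotient of roots of two nonzero polynomials. *)
Lemma good_direction n (P : {mpoly K[n.+1]}) d (L r : {mpoly K[n]}) (w0 : 'I_n -> K) a :
  (forall w, top_coef d (shear w P) L.@[w]) -> L.@[w0] != 0 -> r != 0 ->
  exists2 w, L.@[w] != 0 & forall s, P.@[shear_pt w (shear_proj w a) s] = 0 ->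
    r.@[shear_proj w0 (shear_pt w (shear_proj w a) s)] = 0 -> s = a ord_max.
Proof.
move=> top Lw0 r0; set b := shear_proj w0 a; set s0 := a ord_max.
have [c rc] := mpoly_neq0_point r0; pose w1 i := c i - b i.
have [rho Erho] := mpoly_on_line r b w1.
have rho0 : rho != 0.
  apply: contraNneq rc => rho0; rewrite -(meval_eq (v1 := fun i => b i + w1 i * 1)).
    by rewrite -Erho rho0 horner0.
  by move=> i; rewrite mulr1 addrC subrK.
have [ell Eell] := mpoly_on_line L w0 w1.
have ell0 : ell != 0.
  apply: contraNneq Lw0 => ell0; rewrite -(meval_eq (v1 := fun i => w0 i + w1 i * 0)).
    by rewrite -Eell ell0 horner0.
  by move=> i; rewrite mulr0 addr0.
have fne t : map_poly (meval t) (shear w0 P) != 0.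
  apply: contraNneq Lw0 => /polyP/(_ d); rewrite coef_map coef0 /=.
  by have [_ ->] := top w0; rewrite mevalC => ->.
pose sig (x : K) i := b i + w1 i * x.
have [rr Err] := poly_roots rho0; have [rl Erl] := poly_roots ell0.
pose fr x := sval (poly_roots (fne (sig x))).
have Efr x y : root (map_poly (meval (sig x)) (shear w0 P)) y = (y \in fr x).
  exact: (svalP (poly_roots (fne (sig x)))).
have [mu] := avoid_seq (0 :: rl ++ flatten [seq [seq x / (y - s0) | y <- fr x] | x <- rr]).
rewrite inE mem_cat !negb_or => /and3P[mu0 mul muf].
exists (fun i => w0 i + w1 i * mu); first by rewrite -Eell; move: mul; rewrite -Erl.
set w := fun i => _; move=> s; set x := shear_pt w _ s => Px rx.
apply/eqP; apply: contraNT muf => ss0.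
(* Seen along [w0], the point of height [s] on the new line runs on the fixed line [sig], at
   parameter [mu * (s - s0)]. This parameter is a root of [rho], which leaves finitely many [s], and
   each pair determines [mu]. *)
have projx : shear_proj w0 x = sig (mu * (s - s0)).
  apply/funext => i; rewrite /shear_proj /x /shear_pt widen_rcons_pt rcons_pt_max.
  by rewrite /sig /b /shear_proj /w -/s0; ring.
have xs : x ord_max = s by rewrite /x /shear_pt rcons_pt_max.
have d0 : s - s0 != 0 by rewrite subr_eq0.
have rootr : mu * (s - s0) \in rr by rewrite -Err; apply/rootP; rewrite Erho -/(sig _) -projx.
have roots : s \in fr (mu * (s - s0)).
  by rewrite -Efr; apply/rootP; rewrite -projx -xs shearE shear_pt_proj.
apply/flattenP; exists [seq mu * (s - s0) / (y - s0) | y <- fr (mu * (s - s0))].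
  by apply/mapP; exists (mu * (s - s0)).
by apply/mapP; exists s; rewrite // mulfK.
Qed.

Lemma top_coef_monic n d (q : {poly {mpoly K[n]}}) c : c != 0 -> top_coef d q c ->
  (c^-1)%:MP%:P * q \is monic.
Proof.
move=> c0 [sq qd].
have sq' : size q = d.+1.
  apply/eqP; rewrite eqn_leq sq ltnNge; apply/negP => /leq_sizeP/(_ d (leqnn _)).
  by rewrite qd => /eqP; rewrite mpolyC_eq0 (negPf c0).
by apply/monicP; rewrite lead_coefM lead_coefC lead_coefE sq' qd -mpolyCM mulVf.
Qed.

Theorem euclid_dense_all n : euclid_dense n.
Proof.
elim: n => [|n IHn] U a e cU aU e0.
  have [x Ux] : exists x, U x.
    apply: contrapT => nU; have := aU 1; rewrite meval1 => /(_ _)/eqP.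
    by rewrite oner_eq0 => H; apply: notF; apply: H => x Ux; case: nU; exists x.
  by exists x => // -[].
pose V (J : {mpoly K[n.+1]} -> Prop) x := forall q, J q -> q.@[x] = 0.
pose F J := is_ideal J /\ zariski_closure (fun x => U x /\ V J x) a.
(* [J] is as large as possible with [a] still in the Zariski closure of the part of [U] in its zero
   set; this replaces the choice of an irreducible component through [a]. *)
have [||J [Ji aJ] Jmax] := noetherian_max (@mpoly_noetherian K n.+1) (P := F).
- by move=> J [].
- exists (fun q => q = 0); split.
    by split=> [|p q -> ->|p q ->]; rewrite ?addr0 ?mulr0.
  by move=> q Hq; apply: aU => x Ux; apply: Hq; split=> // _ ->; apply: meval0.
pose p (q : {mpoly K[n.+1]}) := forall x, U x /\ V J x -> q.@[x] = 0.
have Ip : is_ideal p := vanishing_ideal _.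
have Jp q : J q -> p q by move=> Jq x [_]; apply.
have pa q : p q -> q.@[a] = 0 by apply: aJ.
have pp : is_prime p.
  split=> // [/pa|f h pfh].
    by rewrite meval1 => /eqP; rewrite oner_eq0.
  have cl f' : ~ p f' -> exists2 q : {mpoly K[n.+1]},
      (forall x, U x /\ V (add_ideal J f') x -> q.@[x] = 0) & q.@[a] <> 0.
    move=> npf; apply: contrapT => nex; apply: npf; apply: Jp.
    apply: (Jmax (add_ideal J f')).
    - split; first exact: add_ideal_ideal.
      by move=> q Hq; apply: contrapT => qa; apply: nex; exists q.
    - by move=> q Jq; exists 0; rewrite mul0r subr0.
    - by exists 1; rewrite mul1r subrr; apply: ideal0.
  have Vadd f' x : V J x -> f'.@[x] = 0 -> V (add_ideal J f') x.
    move=> Vx f'x q [v /Vx]; rewrite mevalB mevalM f'x mulr0 subr0; exact.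
  (* By maximality, cutting further by either factor gives a polynomial nonzero at [a] that vanishes
     on the corresponding part. The two parts cover everything, so [q1 * q2] is in [p] and must
     vanish at [a]. *)
  apply: contrapT => /not_orP[/cl[q1 H1 q1a] /cl[q2 H2 q2a]].
  have : (q1 * q2).@[a] = 0.
    apply: pa => x [Ux Vx]; rewrite mevalM.
    have /eqP := pfh x (conj Ux Vx); rewrite mevalM mulf_eq0 => /orP[]/eqP E.
      by rewrite H1 ?mul0r //; split=> //; apply: Vadd.
    by rewrite H2 ?mulr0 //; split=> //; apply: Vadd.
  by rewrite mevalM => /eqP; rewrite mulf_eq0 => /orP[]/eqP.
pose U0 x := U x /\ V p x.
have U0E x : U0 x <-> U x /\ V J x.
  split=> [[Ux Vx]|[Ux Vx]]; split=> // q; first by move/Jp/Vx.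
  by apply.
have cU0 : constructible U0.
  have [l lp lgen] := mpoly_noetherian Ip.
  apply: constr_and => //.
  apply: constr_iff (constr_all l (fun q => constr_zero q)) => x.
  split=> [Hl q pq|Vx q /lp]; last exact: Vx.
  exact: (lgen _ (point_ideal x)).
have pU0 q : (forall x, U0 x -> q.@[x] = 0) -> p q.
  by move=> Hq x /U0E/Hq.
(* The second alternative would make [g] vanish on [U0], hence belong to [p]. *)
have [g npg [Ug|Ug]] := constr_generic pp cU0; last first.
  case: npg; apply: pU0 => x U0x; apply/eqP; apply: contrapT => /negP gx.
  by apply: (Ug x) => //; case: U0x.
have Hgoal x : V p x -> g.@[x] != 0 -> U x.
  by move=> Vx gx; case: (Ug x Vx gx).
case: (pselect (exists2 P, p P & P != 0)) => [[P pP P0]|nP]; last first.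
  have g0 : g != 0 by apply: contra_notN npg => /eqP->; apply: ideal0.
  have [x xa gx] := near_neq0 a g0 e0; exists x => //; apply: Hgoal => // q pq.
  have -> : q = 0 by apply/eqP/negPn/negP => q0; apply: nP; exists q.
  exact: meval0.
have [d [L [L0 top]]] := shear_top P0.
have [w0 Lw0] := mpoly_neq0_point L0.
have pM w c : p (unshear w (c%:P * shear w P)).
  have -> : unshear w (c%:P * shear w P) = unshear w c%:P * P.
    by rewrite rmorphM /= unshearK.
  exact: (@idealM _ p _ _ Ip pP).
(* Such an [r] says that the projection along [w0] is not Zariski dense: a better direction exists
   and the induction hypothesis applies to the projection. Otherwise the trace of [p] is zero and
   [p] is principal. *)
case: (pselect (exists2 r : {mpoly K[n]}, p (unshear w0 r%:P) & r != 0)) => [[r pr r0]|nr].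
  have [w Lw line] := good_direction a top Lw0 r0.
  have [|||x U0x xa] := @dense_fibre n w U0 a e _ IHn cU0 _ e0 (top_coef_monic Lw (top w)).
  - by move=> q /pU0; apply: pa.
  - by move=> x [Ux Vx]; apply: Vx.
  - move=> s Hs; apply: line.
      by apply: Hs => x [_ Vx]; apply: Vx.
    have := Hs (unshear w0 r%:P); rewrite unshearE map_polyC hornerC; apply=> x [_ Vx].
    exact: Vx.
  by exists x => //; case: U0x.
have [|x [Vx gx xa]] := dense_hypersurface pp pa npg e0 _ (top_coef_monic Lw0 (top w0)) (pM _ _).
  by move=> r pr; apply/eqP/negPn/negP => r0; apply: nr; exists r.
by exists x => //; apply: Hgoal.
Qed.

End Density.

(** * Stable images of self-maps *)

Section BackwardOrbits.
Variables (T : Type) (X Omega : T -> Prop) (f : T -> T).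

Definition stage k y := exists2 x, Omega x & iter k f x = y.
Definition level k y := stage k y /\ ~ stage k.+1 y.
Definition fin_pred (A : T -> Prop) := exists l : list T, forall x, A x -> List.In x l.

Lemma fin_predU A B : fin_pred A -> fin_pred B -> fin_pred (fun x => A x \/ B x).
Proof.
move=> [l Hl] [m Hm]; exists (l ++ m)%list => x ABx; apply/List.in_app_iff.
by case: ABx => [/Hl|/Hm]; [left|right].
Qed.

Lemma fin_pred_img A (g : T -> T) : fin_pred A -> fin_pred (fun y => exists2 x, A x & g x = y).
Proof. by move=> [l Hl]; exists (List.map g l) => _ [x /Hl xl <-]; apply: List.in_map. Qed.

Lemma fin_pred_sub A B : (forall x, A x -> B x) -> fin_pred B -> fin_pred A.
Proof. by move=> AB [l Hl]; exists l => x /AB/Hl. Qed.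

Lemma eventually_all (l : list T) (Q : T -> nat -> Prop) :
  (forall x, exists K, forall k, (K <= k)%N -> Q x k) ->
  exists K, forall k, (K <= k)%N -> forall x, List.In x l -> Q x k.
Proof.
move=> HQ; elim: l => [|x l [K HK]]; first by exists 0.
have [Kx Hx] := HQ x; exists (maxn Kx K) => k; rewrite geq_max => /andP[kx kK] y.
by case=> [<-|yl]; [apply: Hx|apply: HK].
Qed.

Lemma injective_seq_leaves (z : nat -> T) A : injective z -> fin_pred A ->
  exists K, forall k, (K <= k)%N -> ~ A (z k).
Proof.
move=> zi [l Hl].
have [x|K HK] := @eventually_all l (fun x k => z k <> x).
  case: (pselect (exists k, z k = x)) => [[k0 <-]|nk].
    by exists k0.+1 => k kk0 /zi E; rewrite E ltnn in kk0.
  by exists 0 => k _ E; apply: nk; exists k.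
by exists K => k kK /Hl/(HK k kK).
Qed.

Hypotheses (OX : forall x, Omega x -> X x)
  (Of : forall x, Omega x -> Omega (f x)) (fin_O : fin_pred (fun x => X x /\ ~ Omega x))
  (fin_f : fin_pred (fun y => X y /\ ~ exists2 x, X x & f x = y)).

Lemma iterf_Omega k x : Omega x -> Omega (iter k f x).
Proof. by move=> Ox; elim: k => //= k /Of. Qed.

Lemma stage_anti j k y : (j <= k)%N -> stage k y -> stage j y.
Proof.
move=> jk [x Ox <-]; exists (iter (k - j) f x); first exact: iterf_Omega.
by rewrite -iterD subnKC.
Qed.

Lemma stageS k y : stage k y -> stage k.+1 (f y).
Proof. by case=> x Ox <-; exists x. Qed.

Lemma level0_fin : fin_pred (level 0).
Proof.
apply: fin_pred_sub (fin_predU fin_f (fin_pred_img f fin_O)) => y [[x Ox /= <-] n1].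
case: (pselect (exists2 x', X x' & f x' = x)) => [[x' Xx' fx']|nex].
  right; exists x' => //; split=> // Ox'; apply: n1; by exists x'.
by left; split=> //; apply: OX.
Qed.

Lemma level_iter k y : level k y -> exists2 a, level 0 a & iter k f a = y.
Proof.
move=> [[x Ox fx] nk]; exists x => //; split; first by exists x.
move=> [x' Ox' /= fx']; apply: nk; exists x' => //.
by rewrite iterSr fx'.
Qed.

Lemma level_down j k a : (j <= k)%N -> Omega a -> level k (iter k f a) -> level j (iter j f a).
Proof.
move=> jk Oa [_ nk]; split; first by exists a.
move=> [x Ox fx]; apply: nk; exists x => //.
by rewrite -(subnK jk) iterD -fx -iterD addnS.
Qed.

Lemma level_fin k : fin_pred (level k).
Proof.
by apply: fin_pred_sub (fin_pred_img (iter k f) level0_fin) => y /level_iter.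
Qed.

(** Pigeonhole on the finite set [level 0]: an origin that fails at some level fails at all later
    ones, by [level_down]. *)
Lemma infinite_level_orbit : (forall k, exists y, level k y) ->
  exists2 a, Omega a & forall k, level k (iter k f a).
Proof.
move=> lev; apply: contrapT => nex; have [l Hl] := level0_fin.
have [a|K HK] := @eventually_all l (fun a k => Omega a -> ~ level k (iter k f a)).
  case: (pselect (Omega a)) => [Oa|]; last by exists 0.
  have [k nk] : exists k, ~ level k (iter k f a).
    by apply/existsNP => Ha; apply: nex; exists a.
  by exists k => m km _ Hm; apply: nk; apply: level_down Hm.
have [y Hy] := lev K; have [a la fa] := level_iter Hy.
have Oa : Omega a by case: la => -[x Ox /= <-].
by apply: (HK K (leqnn _) a (Hl _ la) Oa); rewrite fa.
Qed.

Section Orbit.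
Variables (a : T) (Oa : Omega a) (lev : forall k, level k (iter k f a)).

Lemma level_orbit_inj : injective (fun k => iter k f a).
Proof.
suff H i j : (i < j)%N -> iter i f a <> iter j f a.
  by move=> i j E; case: (ltngtP i j) => // /H []; rewrite E.
move=> ij E; have [_ ni] := lev i; apply: ni; rewrite E.
by apply: (stage_anti ij); exists a.
Qed.

(* Only finitely many orbits other than that of [a] start in [level 0]; each of them meets the
   orbit of [a] in a fixed time shift, so that beyond the merging point it adds no new preimage. *)
Lemma level_orbit_preimage : exists K, forall k, (K <= k)%N ->
  forall x, X x -> f x = iter k.+1 f a -> x = iter k f a.
Proof.
have yi := level_orbit_inj.
(* Beyond [K1], the orbit of [a] avoids the images of the points of [X] outside [Omega]. *)
have [K1 HK1] := injective_seq_leaves yi (fin_pred_img f fin_O).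
have [l Hl] := level0_fin.
have [b|K2 HK2] := @eventually_all l (fun b k => forall j, (j <= k)%N ->
    iter j.+1 f b = iter k.+1 f a -> iter j f b = iter k f a).
  case: (pselect (exists j0 k0, iter j0 f b = iter k0 f a)) => [[j0 [k0 E0]]|nE]; last first.
    by exists 0 => k _ j _ E; case: nE; exists j.+1, k.+1.
  have shift t : iter (j0 + t) f b = iter (k0 + t) f a by rewrite addnC iterD E0 -iterD addnC.
  (* An orbit that meets that of [a] is itself without repetition, since its tail is a shift of the
     orbit of [a]; so equal images fix the time [j]. *)
  have bi i i' : iter i f b = iter i' f b -> i = i'.
    move=> E; have : iter (i + j0) f b = iter (i' + j0) f b.
      by rewrite addnC [(i' + j0)%N]addnC !iterD E.
    by rewrite addnC shift addnC [(i' + j0)%N]addnC shift [(k0 + i')%N]addnC => /yi; lia.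
  exists k0 => k kk0 j jk E.
  have : iter j.+1 f b = iter (j0 + (k.+1 - k0)) f b by rewrite shift subnKC ?leqW.
  move/bi => Ej; have -> : j = (j0 + (k - k0))%N by lia.
  by rewrite shift subnKC.
exists (maxn K1 K2) => k; rewrite geq_max => /andP[k1 k2] x Xx fx.
case: (pselect (Omega x)) => [Ox|nOx]; last first.
  by case: (HK1 k.+1 (leqW k1)); exists x.
(* A preimage in [stage k.+1] would put its image in [stage k.+2]; hence [x] has a level at most [k]
   and comes from one of the finitely many origins. *)
have nk : ~ stage k.+1 x by move/stageS; rewrite fx; case: (lev k.+1).
have [j jk [sj nj]] : exists2 j, (j <= k)%N & level j x.
  elim: k {k1 k2 fx} nk => [|k IHk] nk; first by exists 0 => //; split=> //; exists x.
  case: (pselect (stage k.+1 x)) => [sk|/IHk[j jk lj]]; first by exists k.+1.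
  by exists j => //; apply: leqW.
have [b lb fb] := level_iter (conj sj nj).
by rewrite -fb; apply: (HK2 k k2 b (Hl b lb) j jk); rewrite iterS fb.
Qed.

End Orbit.

(* [E] carries an infinite backward orbit of [iter k f a], which must enter [Omega]. *)
Lemma level_stops : (forall a k, Omega a -> (forall k, level k (iter k f a)) ->
    (forall j, (k <= j)%N -> forall x, X x -> f x = iter j.+1 f a -> x = iter j f a) ->
    exists E : T -> Prop, [/\ E (iter k f a), forall x, E x -> X x &
      forall y, E y -> exists2 x, E x & f x = y]) ->
  exists K, forall y, ~ level K y.
Proof.
move=> HE; apply: contrapT => nK.
have [k|a Oa lev] := infinite_level_orbit.
  by apply: contrapT => nk; apply: nK; exists k => y ly; apply: nk; exists y.
have [K HK] := level_orbit_preimage Oa lev.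
have [E [EK EX Esurj]] := HE a K Oa lev HK.
have /choice[g Hg] : forall y, exists x, E y -> E x /\ f x = y.
  move=> y; case: (pselect (E y)) => [/Esurj[x Ex fx]|]; last by exists y.
  by exists x.
pose z m := iter m g (iter K f a).
have Ez m : E (z m) by elim: m => //= m IHm; case: (Hg _ IHm).
have fz m : iter m f (z m) = iter K f a.
  elim: m => // m IHm; rewrite iterSr.
  by have [_ ->] := Hg _ (Ez m).
have zi : injective z.
  suff H i j : (i < j)%N -> z i <> z j.
    by move=> i j Eij; case: (ltngtP i j) => // /H []; rewrite Eij.
  move=> ij Eij; have := fz j; rewrite -Eij -(subnK (ltnW ij)) iterD fz -iterD.
  by move/(level_orbit_inj Oa lev); lia.
have [M HM] := injective_seq_leaves zi fin_O.
(* An index [m >= K.+1] with [z m] in [Omega] exhibits [iter K f a] as a point of [stage K.+1]. *)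
have Om : Omega (z (maxn M K.+1)).
  by apply: contrapT => nO; apply: (HM (maxn M K.+1)) (leq_maxl _ _) _; split=> //; apply: EX.
have [_ nK1] := lev K; apply: nK1; apply: (@stage_anti _ (maxn M K.+1)).
  exact: leq_maxr.
by exists (z (maxn M K.+1)).
Qed.

Lemma stage_stable K : (forall y, ~ level K y) -> forall k, (K <= k)%N ->
  forall y, stage K y <-> stage k y.
Proof.
move=> HK k Kk y; split; last exact: stage_anti.
have KS y' : stage K y' -> stage K.+1 y'.
  by move=> s; apply: contrapT => ns; apply: (HK y').
rewrite -(subnK Kk); elim: (k - K)%N y => // d IHd y /KS[x Ox <-].
rewrite addSn iterS; apply: stageS; apply: IHd; by exists x.
Qed.

Lemma stage_cofinite k : fin_pred (fun x => Omega x /\ ~ stage k x).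
Proof.
elim: k => [|k IHk]; first by exists nil => x [Ox []]; exists x.
apply: fin_pred_sub (fin_predU IHk (level_fin k)) => x [Ox nk].
by case: (pselect (stage k x)) => sk; [right|left].
Qed.

End BackwardOrbits.

(** * Unique preimages under an open polynomial map *)

Section RelativelyOpen.
Variables (R : realType) (N : nat).
Local Notation C := (complex R).
Implicit Types (X U V : ('I_N -> C) -> Prop) (x y : 'I_N -> C).

Lemma complex_gt0_real (c : C) : 0 < c -> exists2 e : R, 0 < e & e%:C%C = c.
Proof.
case: c => a b; rewrite ltcE /= => /andP[/eqP b0 a0].
by exists a => //; rewrite b0.
Qed.

Lemma rel_openP X U : (forall x, U x -> X x) ->
  (forall x, U x -> exists2 e : C, 0 < e & forall y, X y -> near e x y -> U y) -> rel_open X U.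
Proof.
move=> UX HU; split=> // x /HU[c c0 Hc].
by have [e e0 ec] := complex_gt0_real c0; exists e => //; rewrite ec.
Qed.

Lemma rel_open_near X U x : rel_open X U -> U x ->
  exists2 e : C, 0 < e & forall y, X y -> near e x y -> U y.
Proof.
move=> [_ HU] /HU[e e0 He]; exists e%:C%C; first by rewrite ltcR.
by move=> y Xy Hy; apply: He.
Qed.

Lemma rel_openI X U V : rel_open X U -> rel_open X V -> rel_open X (fun x => U x /\ V x).
Proof.
move=> oU oV; apply: rel_openP => [x [/(proj1 oU)]//|x [Ux Vx]].
have [d d0 Hd] := rel_open_near oU Ux; have [e e0 He] := rel_open_near oV Vx.
have [m [m0 md me]] := min_pos d0 e0; exists m => // y Xy xy.
by split; [apply: Hd|apply: He] => //; [apply: near_le md xy|apply: near_le me xy].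
Qed.

(** Exchanging [a] and [b] gives a disjoint set; the two separate points with distinct [i]-th
    coordinates. *)
Lemma rel_open_lt X (i : 'I_N) (a b : C) :
  rel_open X (fun x => X x /\ `|x i - a| < `|x i - b|).
Proof.
apply: rel_openP => [x []//|x [Xx lt]].
exists ((`|x i - b| - `|x i - a|) / 2); first by rewrite divr_gt0 // subr_gt0.
move=> y Xy /(_ i) yx; split=> //; set e := _ / 2 in yx.
have E : `|x i - b| = `|x i - a| + e + e.
  by rewrite -addrA -splitr addrC subrK.
have ya : `|y i - a| < `|x i - a| + e.
  rewrite (_ : y i - a = (x i - a) + (y i - x i)); last by ring.
  by apply: le_lt_trans (ler_normD _ _) _; rewrite ltrD2l.
apply: lt_le_trans ya _; rewrite -(lerD2r e) -E.
rewrite (_ : x i - b = (y i - b) + (x i - y i)); last by ring.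
apply: le_trans (ler_normD _ _) _; rewrite lerD2l distrC; exact: ltW.
Qed.

Lemma rel_open_cofinite X U : (forall x, U x -> X x) ->
  finite_set (fun x => X x /\ ~ U x) -> rel_open X U.
Proof.
move=> UX [l Hl]; apply: rel_openP => // x Ux.
have [e e0 He] : exists2 e : C, 0 < e & forall y, List.In y l -> near e x y -> y = x.
  elim: l {Hl} => [|p l [e e0 He]]; first by exists 1.
  case: (pselect (p = x)) => [->|px].
    by exists e => // y [->|/He].
  have [i pi] : exists i, p i <> x i.
    by apply/existsNP => E; apply: px; apply/funext.
  have d0 : 0 < `|p i - x i| by rewrite normr_gt0 subr_eq0; apply/eqP.
  have [m [m0 me md]] := min_pos e0 d0; exists m => // y [<-|yl] xy.
    by have := lt_le_trans (xy i) md; rewrite ltxx.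
  by apply: He => //; apply: near_le xy.
exists e => // y Xy xy; apply: contrapT => nUy.
by apply: (nUy); rewrite (He y (Hl y (conj Xy nUy)) xy).
Qed.

Lemma rel_open_stage X U (f : ('I_N -> C) -> ('I_N -> C)) k :
  open_map_on X f -> rel_open X U -> rel_open X (stage U f k).
Proof.
move=> fo oU; elim: k => [|k IHk].
  suff -> : stage U f 0 = U by [].
  by apply/funext => x; apply/propext; split=> [[y Uy <-]|Ux]; last exists x.
suff -> : stage U f k.+1 = img f (stage U f k) by exact: fo.
apply/funext => x; apply/propext; split=> [[y Uy <-]|[_ [y Uy <-] <-]]; last by exists y.
by exists (iter k f y) => //; exists y.
Qed.

End RelativelyOpen.

Section UniquePreimage.
Variables (R : realType) (N : nat).
Local Notation C := (complex R).
Variables (S : {mpoly C[N]} -> Prop) (F : 'I_N -> {mpoly C[N]}).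
Local Notation X := (zero_locus S).
Local Notation f := (poly_map F).

(** Points of [X] without preimage are included, so the complement in [X] is the projection of the
    pairs of distinct points with equal image, which Chevalley's theorem handles. *)
Definition unique_preimage y := X y /\ forall x x', X x -> X x' -> f x = y -> f x' = y -> x = x'.

Lemma zero_locus_constr : constructible X.
Proof.
have [l lX lgen] := mpoly_noetherian (vanishing_ideal X).
apply: constr_iff (constr_all l (fun q => constr_zero q)) => x.
split=> [Hl q Sq|Xx q /lX]; last by apply.
apply: (lgen _ (point_ideal x)) => //.
by move=> y Xy; apply: Xy.
Qed.

Lemma constr_eqpt n (G H : 'I_N -> {mpoly C[n]}) :
  constructible (fun z : 'I_n -> C => (fun i => (G i).@[z]) = (fun i => (H i).@[z])).
Proof.
apply: constr_iff (constr_all (enum 'I_N) (fun i => constr_zero (G i - H i))) => z.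
split=> [E|E i _].
  apply/funext => i; apply/eqP; rewrite -subr_eq0 -mevalB; apply/eqP.
  by apply: E; rewrite mem_enum.
by rewrite mevalB (congr1 (fun h => h i) E) subrr.
Qed.

Lemma unique_preimage_constr : constructible unique_preimage.
Proof.
pose M := (N + (N + N))%N.
pose Y i : {mpoly C[M]} := 'X_(lshift (N + N) i).
pose Z1 i : {mpoly C[M]} := 'X_(rshift N (lshift N i)).
pose Z2 i : {mpoly C[M]} := 'X_(rshift N (rshift N i)).
pose FZ Z i : {mpoly C[M]} := mmap (@mpolyC M C) Z (F i).
pose U (y : 'I_N -> C) (s : 'I_(N + N) -> C) :=
  let x := fun i => s (lshift N i) in let x' := fun i => s (rshift N i) in
  [/\ X x, X x', f x = y & f x' = y] /\ ~ (x = x').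
have evY (z : 'I_M -> C) : (fun i => (Y i).@[z]) = (fun i => z (lshift (N + N) i)).
  by apply/funext => i; rewrite mevalXU.
have ev1 (z : 'I_M -> C) : (fun i => (Z1 i).@[z]) = (fun i => z (rshift N (lshift N i))).
  by apply/funext => i; rewrite mevalXU.
have ev2 (z : 'I_M -> C) : (fun i => (Z2 i).@[z]) = (fun i => z (rshift N (rshift N i))).
  by apply/funext => i; rewrite mevalXU.
have evF Z (z : 'I_M -> C) : (fun i => (FZ Z i).@[z]) = f (fun i => (Z i).@[z]).
  by apply/funext => i; exact: (mmap_comp idfun idfun).
clearbody FZ Y Z1 Z2.
have cU : constructible (fun z : 'I_M -> C =>
    U (fun i => z (lshift (N + N) i)) (fun i => z (rshift N i))).
  have c1 := constr_pull Z1 zero_locus_constr; have c2 := constr_pull Z2 zero_locus_constr.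
  have c3 := constr_eqpt (FZ Z1) Y; have c4 := constr_eqpt (FZ Z2) Y.
  have c5 := constr_not (constr_eqpt Z1 Z2).
  apply: constr_iff (constr_and (constr_and (constr_and c1 c2) (constr_and c3 c4)) c5) => z.
  rewrite (evF Z1 z) (evF Z2 z) (evY z) (ev1 z) (ev2 z) /U /=.
  by split=> [[[[? ?] [? ?]] ?]|[[? ? ? ?] ?]].
apply: constr_iff (constr_and zero_locus_constr (constr_not (constr_exists cU))) => y.
split=> -[Xy Hy]; split=> //.
  move=> x x' Xx Xx' fx fx'; apply: contrapT => nxx'; apply: Hy.
  pose s (i : 'I_(N + N)) := match split i with inl j => x j | inr j => x' j end.
  have sl : (fun i => s (lshift N i)) = x.
    by apply/funext => i; rewrite /s (unsplitK (inl i)).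
  have sr : (fun i => s (rshift N i)) = x'.
    by apply/funext => i; rewrite /s (unsplitK (inr i)).
  by exists s; rewrite /U /= sl sr.
by move=> [s [[Xx Xx' fx fx'] nxx']]; apply: nxx'; apply: Hy.
Qed.

(** Two preimages of [y] are separated by [U] and [U'], whose images are open. By [euclid_dense_all]
    some point [u] with at most one preimage lies in both images, and its preimage would have to lie
    in [U] and [U']. *)
Lemma unique_preimage_closed : open_map_on X f ->
  forall y, zariski_closure unique_preimage y -> unique_preimage y.
Proof.
move=> fo y Hy; have Xy : X y by move=> q Sq; apply: Hy => x [Xx _]; apply: Xx.
split=> // x x' Xx Xx' fx fx'; apply: contrapT => nxx'.
have [i xi] : exists i, x i <> x' i.
  by apply/existsNP => E; apply: nxx'; apply/funext.
pose U := fun z => X z /\ `|z i - x i| < `|z i - x' i|.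
pose U' := fun z => X z /\ `|z i - x' i| < `|z i - x i|.
have oU : rel_open X (img f U) by apply: fo; apply: rel_open_lt.
have oU' : rel_open X (img f U') by apply: fo; apply: rel_open_lt.
have yU : img f U y.
  by exists x => //; split=> //; rewrite subrr normr0 normr_gt0 subr_eq0; apply/eqP.
have yU' : img f U' y.
  by exists x' => //; split=> //; rewrite subrr normr0 normr_gt0 subr_eq0 eq_sym; apply/eqP.
have [e e0 He] := rel_open_near (rel_openI oU oU') (conj yU yU').
have [u [Xu uinj] yu] := euclid_dense_all unique_preimage_constr Hy e0.
have [[z [Xz zlt] fz] [z' [Xz' zlt'] fz']] := He u Xu yu.
move: zlt'; rewrite -(uinj z z') // => zlt'.
by have := lt_trans zlt zlt'; rewrite ltxx.
Qed.

Lemma comp_iter_mpoly j (q : {mpoly C[N]}) : exists q', forall x, q'.@[x] = q.@[iter j f x].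
Proof.
elim: j => [|j [q' Hq']]; first by exists q.
exists (mmap (@mpolyC N C) F q') => x; rewrite iterSr -Hq'.
exact: (mmap_comp idfun idfun).
Qed.

(* The points of [X] whose forward orbit consists of points with a unique preimage form a closed
   set, stable under [f], on which [f] is injective, hence surjective by Ax's theorem. *)
Lemma unique_preimage_orbit x0 : (forall x, X x -> X (f x)) -> open_map_on X f ->
  X x0 -> (forall j, unique_preimage (iter j.+1 f x0)) ->
  exists E : ('I_N -> C) -> Prop, [/\ E x0, forall x, E x -> X x &
    forall y, E y -> exists2 x, E x & f x = y].
Proof.
move=> Xf fo X0 W0; pose E x := X x /\ forall j, unique_preimage (iter j.+1 f x).
(* Equations of [E]: those of [X] and, for each [j], the pullbacks along [iter j.+1 f] of the
   polynomials vanishing on [unique_preimage]. They define [E] exactly because [unique_preimage] is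
   Zariski closed. *)
pose J q := S q \/ exists j (q0 : {mpoly C[N]}), (forall y, unique_preimage y -> q0.@[y] = 0) /\
  forall x, q.@[x] = q0.@[iter j.+1 f x].
have EJ x : E x <-> forall q, J q -> q.@[x] = 0.
  split=> [[Xx Wx] q [/Xx//|[j [q0 [Hq0 ->]]]]|Hx]; first exact: Hq0.
  split=> [q Sq|j]; first by apply: Hx; left.
  apply: unique_preimage_closed => // q0 Hq0.
  have [q Hq] := comp_iter_mpoly j.+1 q0.
  by rewrite -Hq; apply: Hx; right; exists j, q0.
have fE x : E x -> E (f x).
  by move=> [Xx Wx]; split=> [|j]; [apply: Xf|rewrite -iterSr; apply: Wx].
have fI x x' : E x -> E x' -> f x = f x' -> x = x'.
  by move=> [Xx /(_ 0)[_ Wx]] [Xx' _] fxx'; apply: Wx.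
exists E; split=> [|x []//|y /EJ Ey]; first by split.
have [||x /EJ Ex fx] := @ax_surjective C N J F _ _ y Ey.
- by move=> x /EJ Ex; apply/EJ; apply: fE.
- by move=> x x' /EJ Ex /EJ Ex'; apply: fI.
by exists x.
Qed.

End UniquePreimage.

Theorem theorem1 (R : realType) (N : nat)
  (S : {mpoly (complex R)[N]} -> Prop)
  (F : 'I_N -> {mpoly (complex R)[N]})
  (Omega : ('I_N -> complex R) -> Prop) :
  let X := zero_locus S in
  let f := poly_map F in
  (forall x, X x -> X (f x)) ->
  open_map_on X f ->
  finite_set (fun y => X y /\ ~ img f X y) ->
  (forall x, Omega x -> X x) ->
  finite_set (fun x => X x /\ ~ Omega x) ->
  (forall x, Omega x -> Omega (f x)) ->
  (exists2 K : nat, (0 < K)%N &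
     forall k : nat, (K <= k)%N ->
       forall y, img (iter K f) Omega y <-> img (iter k f) Omega y) /\
  (let stable := fun y => forall k : nat, (0 < k)%N -> img (iter k f) Omega y in
   rel_open X stable /\ (forall y, stable y -> Omega y) /\
   finite_set (fun x => Omega x /\ ~ stable x)).
Proof.
move=> X f Xf fo fin_f OX fin_O Of.
have [K HK] : exists K, forall y, ~ level Omega f K y.
  apply: (level_stops (X := X)) => // a k Oa lev Hk.
  have Xa j : X (iter j f a) by apply: OX; apply: iterf_Omega.
  apply: unique_preimage_orbit => // [|j]; first exact: Xa.
  rewrite -[iter j.+1 _ _]/(iter j.+1 f (iter k f a)) -iterD; split; first exact: Xa.
  have pre : (k <= j + k)%N by apply: leq_addl.
  by move=> x x' Xx Xx' fx fx'; rewrite (Hk _ pre x) // (Hk _ pre x').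
have stable := stage_stable Of HK.
split.
  (* A positive bound is required, and [K] may be [0]. *)
  exists K.+1 => // k Kk y.
  exact: iff_trans (iff_sym (stable K.+1 (leqnSn K) y)) (stable k (ltnW Kk) y).
move=> st; have -> : st = stage Omega f K.
  apply/funext => y; apply/propext; split=> [H|sK k k0]; first by apply/(stable K.+1 (leqnSn K)); apply: H.
  have [Kk|/ltnW kK] := leqP K k; first by apply/(stable k).
  exact: (stage_anti Of kK).
split; last split.
- apply: rel_open_stage => //; exact: rel_open_cofinite.
- by move=> y [x Ox <-]; apply: iterf_Omega.
- exact: (stage_cofinite OX fin_O fin_f).
Qed.
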